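(* The group $Spin(9)$ acts transitively (by conjugation) on $$\mathcal T_1=\Big\{\mathcal J=\sum_{1\le\alpha<\beta\le9}x_{\alpha\beta}I_\alpha I_\beta:\ x_{\alpha\beta}\in\mathbb R,\ \mathcal J^2=-\mathrm{Id}\Big\}.$$ The isotropy group of the operator $I_1I_2\in\mathcal T_1$ is $Spin(9)\cap U(8)$, and it is isomorphic to $Spin(2)\times_{\mathbb Z_2}Spin(7)$.
   Context: $I_1,\dots,I_9$ are symmetric endomorphisms of Euclidean $\mathbb R^{16}$ with $I_\alpha^2=\mathrm{Id}$ and $I_\alpha I_\beta=-I_\beta I_\alpha$ for $\alpha\ne\beta$. $\mathbb R^9\subset\mathrm{End}(\mathbb R^{16})$ is their span, with the $I_\alpha$ orthonormal, and $Spin(9)\subset SO(16)$ is the group of all products of an even number of unit vectors of this $\mathbb R^9$ (the image of the real spin representation). $U(8)\subset SO(16)$ is the unitary group of the complex structure $I_1I_2$. $Spin(2)\times_{\mathbb Z_2}Spin(7)$ is the quotient of $Spin(2)\times Spin(7)$ by $\{(1,1),(-1,-1)\}$. *)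

(* Defs.v *)
From HB Require Import structures.
From mathcomp Require Import all_boot all_order all_algebra.
From mathcomp Require Import all_classical all_reals all_analysis.

Set Implicit Arguments.
Unset Strict Implicit.
Unset Printing Implicit Defensive.

Import Order.TTheory GRing.Theory Num.Theory.
Import numFieldNormedType.Exports.

Local Open Scope classical_set_scope.
Local Open Scope ring_scope.

Section SpinSet.
Context {R : realType} {A : algType R} {n : nat}.
Implicit Types (e : 'I_n -> A) (v : 'rV[R]_n).

Definition span_vec e v : A := \sum_i v 0 i *: e i.

(* The e i are taken to be orthonormal: span_vec e v is a unit vector of their
   span exactly when v is one of R^n. *)
Definition unit_vector : set 'rV[R]_n := [set v | \sum_i v 0 i ^+ 2 = 1].

Definition spin e : set A :=
  [set x | exists s : seq 'rV[R]_n,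
     [/\ ~~ odd (size s), {in s, forall v, unit_vector v}
       & x = \prod_(v <- s) span_vec e v]].

Definition clifford_relations e :=
  (forall i, e i * e i = 1) /\ (forall i j, i != j -> e i * e j = - (e j * e i)).

Lemma span_vec_sqr e v : clifford_relations e ->
  span_vec e v * span_vec e v = (\sum_i v 0 i ^+ 2)%:A.
Proof.
move=> [e2 eA]; rewrite /span_vec.
pose F i j := (v 0 i * v 0 j) *: (e i * e j).
have -> : (\sum_i v 0 i *: e i) * (\sum_i v 0 i *: e i) = \sum_i \sum_j F i j.
  rewrite mulr_suml; apply: eq_bigr => i _; rewrite mulr_sumr.
  by apply: eq_bigr => j _; rewrite /F -scalerAl -scalerAr scalerA.
suff: (\sum_i \sum_j F i j) *+ 2 = (\sum_i v 0 i ^+ 2)%:A *+ 2.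
  move=> /(congr1 (fun x => (2%:R^-1 : R) *: x)).
  have half (y : A) : (2%:R^-1 : R) *: (y *+ 2) = y.
    by rewrite -[y *+ 2]scaler_nat scalerA mulVf ?pnatr_eq0// scale1r.
  by rewrite !half.
rewrite mulr2n {2}exchange_big/= -big_split/=.
rewrite scaler_suml -sumrMnl; apply: eq_bigr => i _.
rewrite -big_split/= (bigD1 i)//= big1 ?addr0 => [|j ji].
  by rewrite /F e2 -expr2 mulr2n.
by rewrite /F [v 0 j * _]mulrC (eA _ _ ji) scalerN addrN.
Qed.

Lemma unit_vector_sqr e v : clifford_relations e -> unit_vector v ->
  span_vec e v * span_vec e v = 1.
Proof. by move=> ce v1; rewrite span_vec_sqr// v1 scale1r. Qed.

Lemma spin1 e : spin e 1.
Proof. by exists [::]; split => //; rewrite big_nil. Qed.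

Lemma spinM e x y : spin e x -> spin e y -> spin e (x * y).
Proof.
move=> [s [s2 su ->]] [t [t2 tu ->]]; exists (s ++ t); split.
- by rewrite size_cat oddD (negbTE s2) (negbTE t2).
- by move=> v; rewrite mem_cat => /orP[/su|/tu].
- by rewrite big_cat.
Qed.

Lemma spinV e x : clifford_relations e -> spin e x ->
  exists2 y, spin e y & y * x = 1.
Proof.
move=> ce [s [s2 su ->]]; exists (\prod_(v <- rev s) span_vec e v).
  by exists (rev s); split; rewrite ?size_rev// => v; rewrite mem_rev => /su.
elim: s su {s2} => [|v s ih] su; first by rewrite !big_nil mulr1.
rewrite rev_cons -cats1 big_cat/= big_seq1 big_cons -mulrA (mulrA (span_vec e v)).
rewrite unit_vector_sqr ?mul1r; first by apply: ih => w ws; apply: su; rewrite inE ws orbT.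
  by [].
by apply: su; rewrite mem_head.
Qed.

End SpinSet.

Definition symdiff (I : finType) (S T : {set I}) : {set I} :=
  (S :\: T) :|: (T :\: S).

(* The Clifford algebra of R^n with v * v = |v|^2, on the basis e_S indexed by
   the subsets S of 'I_n, where e_S is the increasing product of the e_i, i in
   S. Then e_S e_T = +- e_(S symdiff T), with one sign change for each pair
   j < i with i in S and j in T. The coordinates are stored in a row vector so
   that the algebra inherits the topology of R^(2^n). *)
Definition clifford (R : realType) (n : nat) : Type := 'rV[R]_#|{set 'I_n}|.

HB.instance Definition _ R n := GRing.Lmodule.on (clifford R n).
HB.instance Definition _ R n := Topological.on (clifford R n).

Section Clifford.
Context {R : realType} {n : nat}.
Implicit Types (x y z : clifford R n) (S T U : {set 'I_n}).

Definition cl_coord x S : R := x 0 (enum_rank S).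

Definition cl_of (f : {set 'I_n} -> R) : clifford R n :=
  \row_k f (enum_val k).

Definition cl_sign S T : R := \prod_(i in S) \prod_(j in T | (j < i)%N) -1.

Definition cl_basis S : clifford R n := cl_of (fun T => (T == S)%:R).

Definition cl_mul x y : clifford R n :=
  cl_of (fun S => \sum_T cl_sign T (symdiff T S) *
                         (cl_coord x T * cl_coord y (symdiff T S))).

Definition cl_gen (i : 'I_n) : clifford R n := cl_basis [set i].

Lemma cl_ofK f S : cl_coord (cl_of f) S = f S.
Proof. by rewrite /cl_coord mxE enum_rankK. Qed.

Lemma cl_coordP x y : (forall S, cl_coord x S = cl_coord y S) -> x = y.
Proof.
by move=> xy; apply/rowP => k; have := xy (enum_val k); rewrite /cl_coord enum_valK.
Qed.

Lemma in_symdiff S T i : (i \in symdiff S T) = (i \in S) (+) (i \in T).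
Proof. by rewrite !inE; case: (i \in S); case: (i \in T). Qed.

Lemma symdiffA S T U : symdiff S (symdiff T U) = symdiff (symdiff S T) U.
Proof. by apply/setP => i; rewrite !in_symdiff addbA. Qed.

Lemma symdiffC S T : symdiff S T = symdiff T S.
Proof. by apply/setP => i; rewrite !in_symdiff addbC. Qed.

Lemma symdiff0 S : symdiff S finset.set0 = S.
Proof. by apply/setP => i; rewrite !in_symdiff inE addbF. Qed.

Lemma symdiffSS S : symdiff S S = finset.set0.
Proof. by apply/setP => i; rewrite in_symdiff inE addbb. Qed.

Lemma symdiffK S T : symdiff S (symdiff S T) = T.
Proof. by rewrite symdiffA symdiffSS symdiffC symdiff0. Qed.

Lemma prod_symdiff (P : pred 'I_n) (f : 'I_n -> R) S T : (forall i, f i * f i = 1) ->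
  \prod_(i in symdiff S T | P i) f i =
  (\prod_(i in S | P i) f i) * (\prod_(i in T | P i) f i).
Proof.
move=> f2; rewrite [LHS]big_mkcond [X in _ = X * _]big_mkcond.
rewrite [X in _ = _ * X]big_mkcond -big_split; apply: eq_bigr => i _ /=.
rewrite in_symdiff; case: (P i); rewrite ?andbF ?mulr1 ?andbT//.
by case: (i \in S); case: (i \in T); rewrite /= ?mulr1 ?mul1r ?f2.
Qed.

Lemma cl_sign_sqr S T : cl_sign S T * cl_sign S T = 1.
Proof.
rewrite /cl_sign -big_split big1// => i _.
by rewrite -big_split big1//= => j _; rewrite mulrNN mulr1.
Qed.

Lemma cl_signDl S T U : cl_sign (symdiff S T) U = cl_sign S U * cl_sign T U.
Proof.
rewrite /cl_sign.
have := @prod_symdiff xpredT (fun i => \prod_(j in U | (j < i)%N) -1) S T.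
under eq_bigl do rewrite andbT.
under [X in _ -> _ = X * _]eq_bigl do rewrite andbT.
under [X in _ -> _ = _ * X]eq_bigl do rewrite andbT.
apply=> i.
by rewrite -big_split big1//= => j _; rewrite mulrNN mulr1.
Qed.

Lemma cl_signDr S T U : cl_sign S (symdiff T U) = cl_sign S T * cl_sign S U.
Proof.
rewrite /cl_sign -big_split/=; apply: eq_bigr => i _.
by rewrite (prod_symdiff (fun j : 'I_n => (j < i)%N))// => j; rewrite mulrNN mulr1.
Qed.

Lemma cl_sign0l S : cl_sign finset.set0 S = 1.
Proof. by rewrite /cl_sign big_pred0// => i; rewrite inE. Qed.

Lemma cl_sign0r S : cl_sign S finset.set0 = 1.
Proof. by rewrite /cl_sign big1// => i _; rewrite big_pred0// => j; rewrite inE. Qed.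

Lemma cl_mulA : associative cl_mul.
Proof.
move=> x y z; apply: cl_coordP => S; rewrite !cl_ofK.
pose F T U := cl_sign U (symdiff U S) * cl_sign T (symdiff T U) *
  (cl_coord x T * cl_coord y (symdiff T U) * cl_coord z (symdiff U S)).
transitivity (\sum_T \sum_U F T U); last first.
  rewrite exchange_big; apply: eq_bigr => U _; rewrite cl_ofK.
  by rewrite mulr_suml mulr_sumr; apply: eq_bigr => T _; rewrite /F !mulrA.
apply: eq_bigr => T _; rewrite cl_ofK !mulr_sumr.
have hT : bijective (symdiff T) by exists (symdiff T) => V; rewrite symdiffK.
rewrite (reindex (symdiff T)); last exact: onW_bij.
apply: eq_bigr => U _; rewrite /F.
have -> : symdiff (symdiff T U) (symdiff T S) = symdiff U S.
  by rewrite [symdiff T U]symdiffC -symdiffA symdiffK.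
have -> : cl_sign U (symdiff U S) * cl_sign T (symdiff T U) =
          cl_sign T (symdiff T S) * cl_sign (symdiff T U) (symdiff U S).
  rewrite cl_signDl mulrA -cl_signDr -symdiffA [symdiff U S]symdiffC symdiffK.
  by rewrite mulrC [symdiff S U]symdiffC.
by rewrite !mulrA; congr (_ * _ * _); rewrite -!mulrA; congr (_ * _); rewrite mulrC.
Qed.

Lemma cl_mul1x : left_id (cl_basis finset.set0) cl_mul.
Proof.
move=> x; apply: cl_coordP => S; rewrite cl_ofK (bigD1 finset.set0)//= big1.
  by rewrite addr0 cl_sign0l cl_ofK eqxx !mul1r symdiffC symdiff0.
by move=> T T0; rewrite cl_ofK (negbTE T0) mul0r mulr0.
Qed.

Lemma cl_mulx1 : right_id (cl_basis finset.set0) cl_mul.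
Proof.
move=> x; apply: cl_coordP => S; rewrite cl_ofK (bigD1 S)//= big1.
  by rewrite addr0 symdiffSS cl_sign0r cl_ofK eqxx mul1r mulr1.
move=> T TS; rewrite [cl_coord (cl_basis _) _]cl_ofK.
suff /negbTE -> : symdiff T S != finset.set0 by rewrite !mulr0.
apply: contra TS => /eqP TS0.
by have := symdiffK T S; rewrite TS0 symdiff0 => ->.
Qed.

Lemma cl_coordD x y S : cl_coord (x + y) S = cl_coord x S + cl_coord y S.
Proof. by rewrite /cl_coord mxE. Qed.

Lemma cl_coordZ (a : R) x S : cl_coord (a *: x) S = a * cl_coord x S.
Proof. by rewrite /cl_coord mxE. Qed.

Lemma cl_mulDl : left_distributive cl_mul +%R.
Proof.
move=> x y z; apply: cl_coordP => S; rewrite cl_coordD !cl_ofK -big_split.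
by apply: eq_bigr => T _; rewrite cl_coordD mulrDl mulrDr.
Qed.

Lemma cl_mulDr : right_distributive cl_mul +%R.
Proof.
move=> x y z; apply: cl_coordP => S; rewrite cl_coordD !cl_ofK -big_split.
by apply: eq_bigr => T _; rewrite cl_coordD mulrDr mulrDr.
Qed.

Lemma cl_one_neq0 : cl_basis finset.set0 != 0.
Proof.
apply/eqP => /(congr1 (cl_coord^~ finset.set0)); rewrite cl_ofK eqxx /cl_coord mxE.
exact/eqP/oner_neq0.
Qed.

HB.instance Definition _ := GRing.Zmodule_isNzRing.Build (clifford R n)
  cl_mulA cl_mul1x cl_mulx1 cl_mulDl cl_mulDr cl_one_neq0.

Lemma cl_scalerAl (a : R) x y : a *: (x * y) = (a *: x) * y.
Proof.
apply: cl_coordP => S; rewrite cl_coordZ !cl_ofK mulr_sumr.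
by apply: eq_bigr => T _; rewrite cl_coordZ mulrCA !mulrA.
Qed.

HB.instance Definition _ :=
  GRing.Lmodule_isLalgebra.Build R (clifford R n) cl_scalerAl.

Lemma cl_scalerAr (a : R) x y : a *: (x * y) = x * (a *: y).
Proof.
apply: cl_coordP => S; rewrite cl_coordZ !cl_ofK mulr_sumr.
by apply: eq_bigr => T _; rewrite cl_coordZ mulrCA [a * (_ * _)]mulrCA.
Qed.

HB.instance Definition _ :=
  GRing.Lalgebra_isAlgebra.Build R (clifford R n) cl_scalerAr.

Lemma cl_basisM S T :
  cl_basis S * cl_basis T = cl_sign S T *: cl_basis (symdiff S T).
Proof.
apply: cl_coordP => U; rewrite cl_coordZ !cl_ofK (bigD1 S)//= big1 ?addr0.
  rewrite !cl_ofK eqxx mul1r.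
  have -> : (symdiff S U == T) = (U == symdiff S T).
    by apply/eqP/eqP => [<-|->]; rewrite symdiffK.
  by case: eqP => [->|]; rewrite ?symdiffK ?mulr0.
by move=> V VS; rewrite cl_ofK (negbTE VS) mul0r mulr0.
Qed.

Lemma cl_sign_gen i j : cl_sign [set i] [set j] = if (j < i)%N then -1 else 1.
Proof.
by rewrite /cl_sign big_set1 big_mkcondr big_set1; case: ifP.
Qed.

Lemma cl_gen_relations : clifford_relations cl_gen.
Proof.
split=> [i|i j ij]; rewrite /cl_gen !cl_basisM !cl_sign_gen.
  by rewrite ltnn symdiffSS scale1r.
rewrite symdiffC -scaleNr; congr (_ *: _).
by case: (ltngtP i j) ij => [||/val_inj->]; rewrite ?eqxx ?opprK.
Qed.

End Clifford.

Definition Spin (R : realType) (n : nat) : Type :=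
  set_type (spin (@cl_gen R n)).

HB.instance Definition _ R n := SubChoice.on (Spin R n).
HB.instance Definition _ R n := Topological.on (Spin R n).

Section SpinGroup.
Context {R : realType} {n : nat}.
Implicit Types x y z : Spin R n.

Lemma spinP x : spin cl_gen (set_val x : clifford R n).
Proof. exact: set_valP. Qed.

Definition spin_of (a : clifford R n) (ha : spin cl_gen a) : Spin R n :=
  exist _ a (mem_set ha).

Definition spin_one : Spin R n := spin_of (spin1 cl_gen).

Definition spin_mul x y : Spin R n := spin_of (spinM (spinP x) (spinP y)).

Definition spin_inv x : Spin R n :=
  let y := cid2 (spinV cl_gen_relations (spinP x)) in spin_of (s2valP y).

Lemma spin_mulA : associative spin_mul.
Proof. by move=> x y z; apply: val_inj; rewrite /= mulrA. Qed.

Lemma spin_mul1x : left_id spin_one spin_mul.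
Proof. by move=> x; apply: val_inj; rewrite /= mul1r. Qed.

Lemma spin_mulx1 : right_id spin_one spin_mul.
Proof. by move=> x; apply: val_inj; rewrite /= mulr1. Qed.

Lemma spin_mulVx : left_inverse spin_one spin_inv spin_mul.
Proof.
by move=> x; apply: val_inj; rewrite /= /spin_inv; case: cid2.
Qed.

Lemma spin_mulxV : right_inverse spin_one spin_inv spin_mul.
Proof.
move=> x; rewrite -[LHS]spin_mul1x -(spin_mulVx (spin_inv x)).
rewrite -spin_mulA [spin_mul (spin_inv x) _]spin_mulA spin_mulVx.
by rewrite spin_mul1x.
Qed.

HB.instance Definition _ := isGroup.Build (Spin R n)
  spin_mulA spin_mul1x spin_mulx1 spin_mulVx spin_mulxV.

End SpinGroup.

Section SpinMinusOne.
Context {R : realType} {n : nat}.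

Lemma span_vec_delta (i : 'I_n.+1) (a : R) :
  span_vec (@cl_gen R n.+1) (a *: delta_mx 0 i) = a *: cl_gen i.
Proof.
rewrite /span_vec (bigD1 i)//= big1 => [|j ji]; rewrite !mxE ?eqxx/=.
  by rewrite mulr1 addr0.
by rewrite (negbTE ji) mulr0 scale0r.
Qed.

Lemma unit_vector_delta (i : 'I_n.+1) (a : R) : a ^+ 2 = 1 ->
  unit_vector (a *: delta_mx 0 i).
Proof.
rewrite /unit_vector/= => a2; rewrite (bigD1 i)//= big1 => [|j ji]; rewrite !mxE ?eqxx/=.
  by rewrite mulr1 addr0.
by rewrite (negbTE ji) mulr0 expr0n.
Qed.

Lemma spinN1_subproof : spin (@cl_gen R n.+1) (-1).
Proof.
exists [:: 1 *: delta_mx 0 ord0; (-1) *: delta_mx 0 ord0]; split => //.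
  move=> v; rewrite !inE => /orP[] /eqP ->; apply: unit_vector_delta.
    by rewrite expr1n.
  by rewrite sqrrN expr1n.
rewrite big_cons big_seq1 !span_vec_delta scale1r scaleN1r mulrN.
by rewrite (proj1 cl_gen_relations).
Qed.

Definition spinN1 : Spin R n.+1 := spin_of spinN1_subproof.

End SpinMinusOne.

Section SpinProductQuotient.
Local Open Scope group_scope.
Local Open Scope quotient_scope.
Context {R : realType}.

Let SxS := (Spin R 2 * Spin R 7)%type.
Implicit Types p q r : SxS.

Definition spin27_diag : seq SxS := [:: (1, 1); (spinN1, spinN1)].

Definition spin27_rel p q : bool := p^-1 * q \in spin27_diag.

Lemma spin27_diag1 : 1 \in spin27_diag.
Proof. by rewrite inE eqxx. Qed.

Lemma spinN1_sqr m : (spinN1 : Spin R m.+1) * spinN1 = 1.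
Proof. by apply: val_inj => /=; rewrite mulrNN mulr1. Qed.

Lemma spinN1_central m (x : Spin R m.+1) : spinN1 * x = x * spinN1.
Proof. by apply: val_inj => /=; rewrite mulrN mulNr mulr1 mul1r. Qed.

Lemma spin27_diagM p q :
  p \in spin27_diag -> q \in spin27_diag -> p * q \in spin27_diag.
Proof.
have NN : ((spinN1, spinN1) : SxS) * (spinN1, spinN1) = 1.
  by congr pair; exact: spinN1_sqr.
rewrite !inE => /orP[]/eqP-> /orP[]/eqP->.
- by rewrite mul1g eqxx.
- by rewrite mul1g eqxx orbT.
- by rewrite mulg1 eqxx orbT.
- by rewrite NN eqxx.
Qed.

Lemma spin27_diagC p q : p \in spin27_diag -> p * q = q * p.
Proof.
rewrite !inE => /orP[]/eqP->; first by rewrite mul1g mulg1.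
by congr pair; exact: spinN1_central.
Qed.

Lemma spin27_diagV p : p \in spin27_diag -> p^-1 \in spin27_diag.
Proof.
move=> dp; suff -> : p^-1 = p by [].
apply: (mulgI p); rewrite mulgV; move: dp; rewrite !inE => /orP[]/eqP->.
  by rewrite mul1g.
by congr pair; rewrite spinN1_sqr.
Qed.

Lemma spin27_rel_refl : reflexive spin27_rel.
Proof. by move=> p; rewrite /spin27_rel mulVg spin27_diag1. Qed.

Lemma spin27_rel_sym : symmetric spin27_rel.
Proof.
suff h p q : spin27_rel p q -> spin27_rel q p by move=> p q; apply/idP/idP; exact: h.
by rewrite /spin27_rel => /spin27_diagV; rewrite invgM invgK.
Qed.

Lemma spin27_rel_trans : transitive spin27_rel.
Proof.
move=> q p r; rewrite /spin27_rel => pq qr.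
by have := spin27_diagM pq qr; rewrite -mulgA (mulgA q) mulgV mul1g.
Qed.

Canonical spin27_equiv :=
  EquivRel spin27_rel spin27_rel_refl spin27_rel_sym spin27_rel_trans.

Lemma spin27_relM p p' q q' :
  spin27_rel p p' -> spin27_rel q q' -> spin27_rel (p * q) (p' * q').
Proof.
rewrite /spin27_rel => pp qq.
have -> : (p * q)^-1 * (p' * q') = (p^-1 * p') * (q^-1 * q').
  by rewrite invgM -mulgA (mulgA p^-1) mulgA -(spin27_diagC _ pp) -!mulgA.
exact: spin27_diagM.
Qed.

Lemma spin27_relV p q : spin27_rel p q -> spin27_rel p^-1 q^-1.
Proof.
rewrite /spin27_rel => pq; rewrite invgK.
have -> : p * q^-1 = (p^-1 * q)^-1; last exact: spin27_diagV.
have e : q = (p^-1 * q) * p by rewrite spin27_diagC// mulgA mulgV mul1g.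
by rewrite {1}e invgM mulgA mulgV mul1g.
Qed.

End SpinProductQuotient.

(* Spin(2) x_{Z_2} Spin(7), the cosets of {(1, 1), (-1, -1)} *)
Definition Spin2xSpin7 (R : realType) : Type :=
  quotient_topology {eq_quot (@spin27_equiv R)}%qT.

HB.instance Definition _ R := Choice.on (Spin2xSpin7 R).
HB.instance Definition _ R := Topological.on (Spin2xSpin7 R).

Section Spin2xSpin7Group.
Local Open Scope group_scope.
Local Open Scope quotient_scope.
Context {R : realType}.

Local Notation Q := (Spin2xSpin7 R).
Implicit Types p q : (Spin R 2 * Spin R 7)%type.
Implicit Types x y z : Q.

Definition spin27_pi p : Q := \pi_{eq_quot (@spin27_equiv R)} p.

Let rep x : Spin R 2 * Spin R 7 := repr (x : {eq_quot (@spin27_equiv R)}).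

Lemma spin27_piP p q : reflect (spin27_pi p = spin27_pi q) (spin27_rel p q).
Proof.
exact: (@eqmodP _ (@spin27_equiv R) p q).
Qed.

Let repK x : spin27_pi (rep x) = x. Proof. exact: reprK. Qed.

Let rep_pi p : spin27_rel (rep (spin27_pi p)) p.
Proof. by apply/spin27_piP; rewrite repK. Qed.

Definition spin27_one : Q := spin27_pi 1.
Definition spin27_mul x y : Q := spin27_pi (rep x * rep y).
Definition spin27_inv x : Q := spin27_pi (rep x)^-1.

Lemma spin27_piM p q : spin27_mul (spin27_pi p) (spin27_pi q) = spin27_pi (p * q).
Proof. by apply/spin27_piP; apply: spin27_relM. Qed.

Lemma spin27_piV p : spin27_inv (spin27_pi p) = spin27_pi p^-1.
Proof. by apply/spin27_piP; apply: spin27_relV. Qed.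

Lemma spin27_mulA : associative spin27_mul.
Proof.
by move=> x y z; rewrite -(repK x) -(repK y) -(repK z) !spin27_piM mulgA.
Qed.

Lemma spin27_mul1x : left_id spin27_one spin27_mul.
Proof. by move=> x; rewrite -(repK x) spin27_piM mul1g. Qed.

Lemma spin27_mulx1 : right_id spin27_one spin27_mul.
Proof. by move=> x; rewrite -(repK x) spin27_piM mulg1. Qed.

Lemma spin27_mulVx : left_inverse spin27_one spin27_inv spin27_mul.
Proof. by move=> x; rewrite -(repK x) spin27_piV spin27_piM mulVg. Qed.

Lemma spin27_mulxV : right_inverse spin27_one spin27_inv spin27_mul.
Proof. by move=> x; rewrite -(repK x) spin27_piV spin27_piM mulgV. Qed.

HB.instance Definition _ := isGroup.Build Q
  spin27_mulA spin27_mul1x spin27_mulx1 spin27_mulVx spin27_mulxV.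

End Spin2xSpin7Group.

Section ConjugationAction.
Context {R : realType} {m : nat}.
Implicit Types (G X : set 'M[R]_m) (g J : 'M[R]_m).

Definition conj_mx g J : 'M[R]_m := g *m J *m invmx g.

Definition acts_by_conj G X := forall g J, G g -> X J -> X (conj_mx g J).

Definition acts_transitively_by_conj G X :=
  [/\ acts_by_conj G X, X !=set0
    & forall J J', X J -> X J' -> exists2 g, G g & conj_mx g J = J'].

Definition isotropy G J : set 'M[R]_m := [set g | G g /\ conj_mx g J = J].

(* When J is an orthogonal complex structure, g preserves the Hermitian product
   iff it is orthogonal and commutes with J. *)
Definition unitary_group J : set 'M[R]_m :=
  [set g | g^T *m g = 1%:M /\ g *m J = J *m g].

(* Isomorphism of topological groups; G carries the subspace topology of the
   m x m matrices. Between compact Lie groups it is automatically smooth. *)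
Definition isomorphic_to_mx_group (Q : topologicalType) (mulQ : Q -> Q -> Q) G :=
  exists (f : Q -> G) (h : G -> Q),
    [/\ cancel f h, cancel h f, continuous f, continuous h
      & forall x y,
          set_val (f (mulQ x y)) = (set_val (f x) : 'M[R]_m) *m set_val (f y)].

End ConjugationAction.

Definition calT1 (R : realType) (I : 'I_9 -> 'M[R]_16) : set 'M[R]_16 :=
  [set J | (exists x : 'I_9 -> 'I_9 -> R,
              J = \sum_(a < 9) \sum_(b < 9 | (a < b)%N) x a b *: (I a *m I b))
           /\ J *m J = - 1%:M].

(* Main.v *)
(* The products e_S over even S are trace-orthogonal, so the even Clifford algebra
   embeds in the matrices, and an even element commuting with all generators but
   the last is a scalar. Hence an element of Spin commuting with e_0, ..., e_(k-1)
   is a product of unit vectors orthogonal to them: undo its effect on e_k by two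
   reflections and iterate.

   Transitivity: J^2 = -1 forces the skew map v |-> [J, v] / 2 to be a complex
   structure on its image, and a trace computation shows that J = w v for w, v
   orthonormal, which reflections carry to I_1 I_2.

   Isotropy: an element fixing I_1 I_2 preserves the oriented plane of I_1 and I_2,
   so it is a rotation of that plane times an element of Spin commuting with I_1
   and I_2. The resulting bijection from Spin(2) x_{Z_2} Spin(7) is a
   homeomorphism because Spin(2) and Spin(7) are compact. *)
From HB Require Import structures.
Require Import Defs.
From mathcomp Require Import all_boot all_order all_algebra.
From mathcomp Require Import all_classical all_reals all_analysis.
From mathcomp Require Import ring lra.

Set Implicit Arguments.
Unset Strict Implicit.
Unset Printing Implicit Defensive.

Import Order.TTheory GRing.Theory Num.Theory.
Import numFieldNormedType.Exports.

Local Open Scope classical_set_scope.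
Local Open Scope ring_scope.

(** * Universal property of the Clifford algebra *)

Section CliffordLift.
Context {R : realType} {A : algType R} {n : nat} (e : 'I_n -> A).
Hypothesis e_rel : clifford_relations e.
Implicit Types (x y : clifford R n) (S T U : {set 'I_n}) (i j : 'I_n).

Definition cl_prod S : A := \prod_(i in S) e i.

Definition cl_lift x : A := \sum_S cl_coord x S *: cl_prod S.

(** The sign met when [e i] is carried across [cl_prod S]: one -1 for each factor other than [e i]
    itself. *)
Definition exchange_sign i S : R := \prod_(j in S) if j == i then 1 else -1.

Lemma exchange_signE i S : exchange_sign i S = (-1) ^+ (#|S| + (i \in S)).
Proof.
rewrite /exchange_sign; have [iS|/negP iS] := boolP (i \in S).
  rewrite (bigD1 i)//= eqxx mul1r (eq_bigr (fun=> -1 : R)); last first.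
    by move=> j /andP[_ /negbTE ->].
  rewrite prodr_const addn1 [in RHS](cardD1 i) iS/= add1n -[RHS]signr_odd/=.
  rewrite negbK signr_odd; congr (_ ^+ _); apply: eq_card => j.
  by rewrite !inE andbC.
rewrite (eq_bigr (fun=> -1 : R)) ?prodr_const ?addn0// => j jS.
by case: eqP => // ji; case: iS; rewrite -ji.
Qed.

(** Stated for a list and a predicate so that it also applies to an initial part of the enumeration,
    in [mul_gen_cl_prod]. *)
Lemma mul_gen_prod_seq i (s : seq 'I_n) (P : pred 'I_n) :
  e i * \prod_(j <- s | P j) e j =
  (\prod_(j <- s | P j) if j == i then 1 else -1 : R) *:
    (\prod_(j <- s | P j) e j * e i).
Proof.
elim: s => [|j s ih]; first by rewrite !big_nil scale1r mulr1 mul1r.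
rewrite !big_cons; case: (P j) => //.
have ij : e i * e j = (if j == i then 1 else -1 : R) *: (e j * e i).
  case: eqP => [->|/eqP ji]; first by rewrite scale1r.
  by rewrite scaleN1r e_rel.2// eq_sym.
by rewrite mulrA ij -scalerAl -(mulrA (e j) (e i)) ih -scalerAr scalerA mulrA.
Qed.

Lemma mul_gen_prod i S : e i * cl_prod S = exchange_sign i S *: (cl_prod S * e i).
Proof. exact: mul_gen_prod_seq. Qed.

Lemma cl_prod0 : cl_prod finset.set0 = 1.
Proof. by rewrite /cl_prod big_pred0// => i; rewrite inE. Qed.

Lemma cl_prod1 i : cl_prod [set i] = e i.
Proof. by rewrite /cl_prod big_set1. Qed.

(** Serves to cut an increasing product at the place where [e i] belongs. *)
Lemma enum_split i : exists s t,
  [/\ index_enum 'I_n = s ++ i :: t, forall j, j \in s -> (j < i)%N &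
      forall j, j \in t -> (i < j)%N].
Proof.
have iE : i \in enum 'I_n by rewrite mem_enum.
have : sorted ltn (map val (enum 'I_n)) by rewrite val_enum_ord iota_ltn_sorted.
rewrite (_ : index_enum _ = enum 'I_n); last by rewrite enumT [index_enum _]unlock.
case/splitPr: iE => s t; rewrite map_cat/= sorted_pairwise; last exact: ltn_trans.
rewrite pairwise_cat/= => /and3P[st _ /andP[it _]]; exists s, t; split=> // j js.
  move: st; rewrite allrel_consr => /andP[/allP si _].
  by apply: si; rewrite map_f.
by move/allP: it; apply; rewrite map_f.
Qed.

Lemma cl_sign_setl i S : cl_sign [set i] S = \prod_(j in S | (j < i)%N) -1 :> R.
Proof. by rewrite /cl_sign big_set1. Qed.

(** [e i] crosses the factors of index below [i], each costing a sign, and then either fills its own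
    empty place or cancels against the [e i] found there. *)
Lemma mul_gen_cl_prod i S :
  e i * cl_prod S = cl_sign [set i] S *: cl_prod (symdiff [set i] S).
Proof.
have [s [t [st si ti]]] := enum_split i.
rewrite cl_sign_setl /cl_prod st !big_cat/= !big_cons.
have in_ne j : j != i -> (j \in symdiff [set i] S) = (j \in S).
  by move=> /negbTE ji; rewrite in_symdiff inE ji.
have si' j : j \in s -> j != i by move=> /si; apply: contraTneq => ->; rewrite ltnn.
have ti' j : j \in t -> j != i by move=> /ti; apply: contraTneq => ->; rewrite ltnn.
rewrite ltnn andbF in_symdiff inE eqxx/=.
have -> : \prod_(j <- t | (j \in S) && (j < i)%N) -1 = 1 :> R.
  rewrite big1_seq// => j /andP[/andP[_ ji] /ti ij].
  by move: (ltn_trans ij ji); rewrite ltnn.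
have -> : \prod_(j <- s | j \in symdiff [set i] S) e j = \prod_(j <- s | j \in S) e j.
  by rewrite big_seq_cond [RHS]big_seq_cond; apply: eq_bigl => j;
     apply: andb_id2l => /si'/in_ne.
have -> : \prod_(j <- t | j \in symdiff [set i] S) e j = \prod_(j <- t | j \in S) e j.
  by rewrite big_seq_cond [RHS]big_seq_cond; apply: eq_bigl => j;
     apply: andb_id2l => /ti'/in_ne.
rewrite mulr1 (mulrA (e i)) (mul_gen_prod_seq i s) -scalerAl.
congr (_ *: _).
  rewrite big_seq_cond [RHS]big_seq_cond; apply: eq_big => [j|j /andP[/si' /negbTE ->]//].
  by case: (boolP (j \in s)) => //= /si ->; rewrite andbT.
by case: (i \in S) => /=; rewrite -!mulrA// (mulrA (e i)) e_rel.1 mul1r.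
Qed.

(** Induction on [#|S|], splitting off one generator. Any [i] in [S] will do, not only the least,
    because the sign is multiplicative in each argument and squares to 1. *)
Lemma cl_prodM S T : cl_prod S * cl_prod T = cl_sign S T *: cl_prod (symdiff S T).
Proof.
have [k] := ubnP #|S|; elim: k S => // k ih S; have [->|S0] := eqVneq S finset.set0.
  by rewrite cl_prod0 mul1r cl_sign0l scale1r symdiffC symdiff0.
case/set0Pn: S0 => i iS Sk; pose S' := S :\ i.
have S'i : symdiff [set i] S' = S.
  by apply/setP => j; rewrite in_symdiff !inE; case: eqP => [->|].
have cS' : (#|S'| < k)%N by move: Sk; rewrite (cardsD1 i) iS ltnS.
have -> : cl_prod S = cl_sign [set i] S' *: (e i * cl_prod S').
  rewrite mul_gen_cl_prod scalerA S'i.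
  by rewrite cl_sign_sqr scale1r.
rewrite -scalerAl -mulrA ih// -scalerAr mul_gen_cl_prod.
rewrite symdiffA S'i !scalerA; congr (_ *: _).
have -> : cl_sign S T = cl_sign [set i] T * cl_sign S' T :> R by rewrite -cl_signDl S'i.
by rewrite cl_signDr mulrACA cl_sign_sqr mul1r mulrC.
Qed.

Lemma cl_lift_is_linear : linear cl_lift.
Proof.
move=> a x y; rewrite /cl_lift scaler_sumr -big_split; apply: eq_bigr => S _ /=.
by rewrite cl_coordD cl_coordZ scalerDl scalerA.
Qed.

HB.instance Definition _ :=
  GRing.isLinear.Build R (clifford R n) A *:%R cl_lift cl_lift_is_linear.

Lemma cl_lift_basis S : cl_lift (cl_basis S) = cl_prod S.
Proof.
rewrite /cl_lift (bigD1 S)//= cl_ofK eqxx scale1r big1 ?addr0// => T TS.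
by rewrite cl_ofK (negbTE TS) scale0r.
Qed.

Lemma cl_lift1 : cl_lift 1 = 1.
Proof. by rewrite cl_lift_basis cl_prod0. Qed.

Lemma cl_liftM x y : cl_lift (x * y) = cl_lift x * cl_lift y.
Proof.
rewrite /cl_lift mulr_suml.
under [RHS]eq_bigr => T _ do rewrite mulr_sumr.
pose F T U := cl_coord x T * cl_coord y U * cl_sign T U *: cl_prod (symdiff T U).
transitivity (\sum_T \sum_U F T U); last first.
  apply: eq_bigr => T _; apply: eq_bigr => U _.
  by rewrite -[RHS]scalerAl -scalerAr cl_prodM !scalerA.
transitivity (\sum_S \sum_T F T (symdiff T S)).
  apply: eq_bigr => S _; rewrite cl_ofK scaler_suml; apply: eq_bigr => T _.
  by rewrite /F symdiffK mulrC.
rewrite exchange_big; apply: eq_bigr => T _.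
rewrite [RHS](reindex (symdiff T))//=.
by exists (symdiff T) => V _; rewrite symdiffK.
Qed.

Lemma cl_lift_span v : cl_lift (span_vec cl_gen v) = span_vec e v.
Proof.
rewrite /span_vec linear_sum; apply: eq_bigr => i _.
by rewrite linearZ/= cl_lift_basis cl_prod1.
Qed.

Lemma cl_lift_prod_span (s : seq 'rV[R]_n) :
  cl_lift (\prod_(v <- s) span_vec cl_gen v) = \prod_(v <- s) span_vec e v.
Proof.
elim: s => [|v s ih]; first by rewrite !big_nil cl_lift1.
by rewrite !big_cons cl_liftM cl_lift_span ih.
Qed.

Lemma spin_cl_lift (a : A) :
  spin e a <-> exists2 x, spin cl_gen x & cl_lift x = a.
Proof.
split=> [[s [s2 su ->]]|[_ [s [s2 su ->]] <-]].
  exists (\prod_(v <- s) span_vec cl_gen v); last exact: cl_lift_prod_span.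
  by exists s.
by exists s; split=> //; rewrite cl_lift_prod_span.
Qed.

End CliffordLift.

(** * Parity, vectors and reflections *)

Section CliffordParity.
Context {R : realType} {n : nat}.
Implicit Types (x y : clifford R n) (S T : {set 'I_n}) (b c : bool).

(** [cl_parity false] is the even subalgebra, [cl_parity true] the odd subspace. *)
Definition cl_parity b x := forall S, odd #|S| != b -> cl_coord x S = 0.

Lemma odd_card_symdiff S T : odd #|symdiff S T| = odd #|S| (+) odd #|T|.
Proof.
rewrite /symdiff cardsU (_ : _ :&: _ = finset.set0) ?cards0 ?subn0; last first.
  by apply/setP => i; rewrite !inE; case: (i \in S); case: (i \in T).
rewrite oddD !cardsD !oddB ?subset_leq_card ?finset.subsetIl// finset.setIC.
by case: (odd #|S|); case: (odd #|T|); case: (odd _).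
Qed.

Lemma cl_parity1 : cl_parity false 1.
Proof.
by move=> S oS; rewrite cl_ofK; case: eqVneq => [S0|//]; rewrite S0 cards0 in oS.
Qed.

Lemma cl_parityM b c x y :
  cl_parity b x -> cl_parity c y -> cl_parity (b (+) c) (x * y).
Proof.
move=> xb yc S oS; rewrite cl_ofK big1// => T _.
have [oT|/xb ->] := eqVneq (odd #|T|) b; last by rewrite mul0r mulr0.
rewrite yc ?mulr0//; apply: contra oS => /eqP <-.
by rewrite odd_card_symdiff oT addbA addbb.
Qed.

Lemma cl_parity_span v : cl_parity true (span_vec cl_gen v).
Proof.
move=> S oS; rewrite /span_vec /cl_coord summxE big1// => i _.
rewrite -[LHS]/(cl_coord (v 0 i *: cl_gen i) S) cl_coordZ cl_ofK.
by case: eqVneq => [S1|]; rewrite ?mulr0//; rewrite S1 cards1 in oS.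
Qed.

Lemma cl_parity_spin x : spin cl_gen x -> cl_parity false x.
Proof.
move=> [s [/negbTE s2 _ ->]]; rewrite -s2; elim: s {s2} => [|v s ih].
  by rewrite big_nil; exact: cl_parity1.
by rewrite big_cons -[odd _]/(true (+) odd (size s)); apply: cl_parityM ih; exact: cl_parity_span.
Qed.

End CliffordParity.

Section DotProduct.
Context {R : realType} {n : nat}.
Implicit Types u v w : 'rV[R]_n.

Definition dot u v : R := \sum_i u 0 i * v 0 i.

Lemma dotC u v : dot u v = dot v u.
Proof. by apply: eq_bigr => i _; rewrite mulrC. Qed.

Lemma dotDl u v w : dot (u + v) w = dot u w + dot v w.
Proof. by rewrite -big_split; apply: eq_bigr => i _; rewrite mxE mulrDl. Qed.

Lemma dotDr u v w : dot w (u + v) = dot w u + dot w v.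
Proof. by rewrite dotC dotDl !(dotC w). Qed.

Lemma dotZl (a : R) u v : dot (a *: u) v = a * dot u v.
Proof. by rewrite mulr_sumr; apply: eq_bigr => i _; rewrite mxE mulrA. Qed.

Lemma dotZr (a : R) u v : dot u (a *: v) = a * dot u v.
Proof. by rewrite dotC dotZl dotC. Qed.

Lemma dot_deltar u i : dot u (delta_mx 0 i) = u 0 i.
Proof.
rewrite /dot (bigD1 i)//= big1 => [|j /negbTE ji]; rewrite !mxE ?eqxx ?mulr1 ?addr0//.
by rewrite ji andbF mulr0.
Qed.

Lemma dot_ge0 v : 0 <= dot v v.
Proof. by apply: sumr_ge0 => i _; rewrite -expr2 sqr_ge0. Qed.

Lemma dot_eq0 v : dot v v = 0 -> v = 0.
Proof.
move=> /eqP; rewrite psumr_eq0 => [/allP v0|i _]; last by rewrite -expr2 sqr_ge0.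
apply/rowP => i; rewrite mxE; have := v0 i (mem_index_enum _).
by rewrite mulf_eq0 orbb => /eqP.
Qed.

Lemma unit_vectorE v : unit_vector v <-> dot v v = 1.
Proof. by rewrite /unit_vector/= /dot; under eq_bigr do rewrite expr2. Qed.

Lemma unit_vector_normalize v : v != 0 ->
  unit_vector ((Num.sqrt (dot v v))^-1 *: v).
Proof.
move=> v0; apply/unit_vectorE; rewrite dotZl dotZr mulrA -invfM -expr2.
by rewrite sqr_sqrtr ?dot_ge0// mulVf//; apply: contra v0 => /eqP/dot_eq0 ->.
Qed.

Lemma dot_delta i : dot (delta_mx 0 i) (delta_mx 0 i) = 1.
Proof. by rewrite dot_deltar mxE !eqxx. Qed.

Lemma unit_delta i : unit_vector (delta_mx 0 i : 'rV[R]_n).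
Proof. exact/unit_vectorE/dot_delta. Qed.

End DotProduct.

Section SpanVec.
Context {R : realType} {A : algType R} {n : nat} (e : 'I_n -> A).
Implicit Types u v w : 'rV[R]_n.

Lemma span_vec_is_linear : linear (span_vec e).
Proof.
move=> a u v; rewrite /span_vec scaler_sumr -big_split; apply: eq_bigr => i _.
by rewrite !mxE scalerDl scalerA.
Qed.

HB.instance Definition _ :=
  GRing.isLinear.Build R 'rV[R]_n A *:%R (span_vec e) span_vec_is_linear.

Lemma span_vec_gen i : span_vec e (delta_mx 0 i) = e i.
Proof.
rewrite /span_vec (bigD1 i)//= big1 => [|j ji]; rewrite mxE ?eqxx ?scale1r ?addr0//.
by rewrite (negbTE ji) andbF scale0r.
Qed.

Hypothesis e_rel : clifford_relations e.

Lemma span_vecK v : span_vec e v * span_vec e v = (dot v v)%:A.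
Proof.
by rewrite span_vec_sqr//; congr (_ *: _); apply: eq_bigr => i _; rewrite expr2.
Qed.

Lemma span_vec_unit v : unit_vector v -> span_vec e v * span_vec e v = 1.
Proof. exact: unit_vector_sqr. Qed.

(** Polarization of [span_vecK] at [u + v]. *)
Lemma span_vec_anticomm u v :
  span_vec e u * span_vec e v = (2 * dot u v)%:A - span_vec e v * span_vec e u.
Proof.
have := span_vecK (u + v); rewrite linearD/= mulrDl !mulrDr !span_vecK.
rewrite dotDl !dotDr (dotC v u) !scalerDl -!addrA => /addrI; rewrite !addrA.
move=> /addIr uv; apply/eqP; rewrite eq_sym subr_eq uv.
by rewrite mulr_natl mulr2n scalerDl.
Qed.

Lemma span_vec_orth u v : dot u v = 0 ->
  span_vec e u * span_vec e v = - (span_vec e v * span_vec e u).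
Proof. by move=> uv; rewrite span_vec_anticomm uv mulr0 scale0r sub0r. Qed.

(** Reads orthogonality off a relation between operators, so that it can be carried through a
    conjugation. *)
Lemma span_vec_orthP u v :
  span_vec e u * span_vec e v = - (span_vec e v * span_vec e u) -> dot u v = 0.
Proof.
move=> uv; have := span_vec_anticomm u v; rewrite uv -[LHS]add0r => /addIr/esym/eqP.
by rewrite scaler_eq0 oner_eq0 orbF mulf_eq0 pnatr_eq0 => /eqP.
Qed.

Lemma span_vec_eq0 v : span_vec e v = 0 -> v = 0.
Proof.
move=> v0; apply: dot_eq0; have /eqP := span_vecK v.
by rewrite v0 mulr0 eq_sym scaler_eq0 oner_eq0 orbF => /eqP.
Qed.

(** Conjugation by a unit vector is the negative of the reflection in its orthogonal hyperplane: [v]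
    is fixed and the vectors orthogonal to it are negated. *)
Lemma span_vec_reflect v w : unit_vector v ->
  span_vec e v * span_vec e w * span_vec e v =
  span_vec e ((2 * dot v w) *: v - w).
Proof.
move=> v1; rewrite span_vec_anticomm mulrBl -mulrA span_vec_unit// mulr1.
by rewrite -scalerAl mul1r linearB linearZ.
Qed.

(* A reflection carrying w to u, up to sign: along the bisector of u and w, or
   along v0 when u = - w. *)
Lemma exists_reflection u w v0 :
  unit_vector u -> unit_vector w -> unit_vector v0 -> dot v0 w = 0 ->
  exists v, [/\ unit_vector v,
    span_vec e v * span_vec e w * span_vec e v = span_vec e u &
    forall i, u 0 i = 0 -> w 0 i = 0 -> v0 0 i = 0 -> v 0 i = 0].
Proof.
move=> u1 w1 v01 v0w; have [uw|uw] := eqVneq (u + w) 0.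
  exists v0; split=> //; rewrite span_vec_reflect// v0w mulr0 scale0r sub0r.
  by congr span_vec; apply/eqP; rewrite eq_sym -addr_eq0 uw.
exists ((Num.sqrt (dot (u + w) (u + w)))^-1 *: (u + w)).
have v1 := unit_vector_normalize uw; split=> // [|i ui wi _]; last first.
  by rewrite !mxE ui wi addr0 mulr0.
rewrite span_vec_reflect//; congr span_vec; rewrite dotZl scalerA.
set q := Num.sqrt _.
have d0 : dot (u + w) (u + w) != 0 by apply: contra uw => /eqP/dot_eq0 ->.
(* As [u] and [w] have equal length, |u + w|^2 = 2 <u + w, w>; this makes the coefficient of [u + w]
   equal to 1. *)
have q2 : q ^+ 2 = 2 * dot (u + w) w.
  rewrite sqr_sqrtr ?dot_ge0//; move: u1 w1 => /unit_vectorE u1 /unit_vectorE w1.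
  by rewrite !dotDl !dotDr u1 w1 (dotC w u) mulr_natl mulr2n [1 + _]addrC.
have q0 : q != 0 by rewrite sqrtr_eq0 -ltNge lt0r d0 dot_ge0.
have -> : 2 * (q^-1 * dot (u + w) w) * q^-1 = 1.
  by rewrite -[RHS](divff (expf_neq0 2 q0)) {1}q2; field.
by rewrite scale1r addrK.
Qed.

Lemma prod_anticomm (a : A) (s : seq 'rV[R]_n) :
  {in s, forall v, span_vec e v * a = - (a * span_vec e v)} ->
  (\prod_(v <- s) span_vec e v) * a =
  (-1) ^+ size s *: (a * \prod_(v <- s) span_vec e v).
Proof.
elim: s => [|v s ih] sa; first by rewrite !big_nil mul1r mulr1 scale1r.
rewrite !big_cons -mulrA ih => [|w ws]; last by apply: sa; rewrite inE ws orbT.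
rewrite -scalerAr (mulrA (span_vec e v) a) sa ?mem_head// mulNr scalerN -scaleNr -mulrA/=.
by rewrite exprS mulN1r.
Qed.

Lemma prod_even_comm (a : A) (s : seq 'rV[R]_n) : ~~ odd (size s) ->
  {in s, forall v, span_vec e v * a = - (a * span_vec e v)} ->
  (\prod_(v <- s) span_vec e v) * a = a * \prod_(v <- s) span_vec e v.
Proof.
by move=> /negbTE s2 /prod_anticomm ->; rewrite -signr_odd s2 scale1r.
Qed.

End SpanVec.

(** * Factorization into reflections *)

Section SymmetricCliffordFamily.
Context {R : realType} {m n : nat} (e : 'I_n -> 'M[R]_m.+1).
Hypothesis e_rel : clifford_relations e.
Hypothesis e_sym : forall i, (e i)^T = e i.
Implicit Types (x y a : 'M[R]_m.+1) (c : clifford R n) (S T : {set 'I_n}).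
Implicit Types (u v w : 'rV[R]_n) (s : seq 'rV[R]_n).

Lemma trmxM x y : (x * y)^T = y^T * x^T. Proof. exact: trmx_mul. Qed.

Lemma orthogonalC x : x^T * x = 1 -> x * x^T = 1. Proof. exact: mulmx1C. Qed.

Lemma orthogonalM x y : x^T * x = 1 -> y^T * y = 1 -> (x * y)^T * (x * y) = 1.
Proof. by move=> x1 y1; rewrite trmxM -mulrA (mulrA x^T) x1 mul1r. Qed.

Lemma span_vec_sym v : (span_vec e v)^T = span_vec e v.
Proof. by rewrite linear_sum; apply: eq_bigr => i _; rewrite linearZ/= e_sym. Qed.

Lemma span_vec_orthogonal v : unit_vector v ->
  (span_vec e v)^T * span_vec e v = 1.
Proof. by move=> v1; rewrite span_vec_sym span_vec_unit. Qed.

Lemma prod_span_orthogonal s : {in s, forall v, unit_vector v} ->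
  (\prod_(v <- s) span_vec e v)^T * \prod_(v <- s) span_vec e v = 1.
Proof.
elim: s => [|v s ih] su; first by rewrite big_nil trmx1 mulr1.
rewrite big_cons; apply: orthogonalM.
  by apply: span_vec_orthogonal; apply: su; rewrite mem_head.
by apply: ih => w ws; apply: su; rewrite inE ws orbT.
Qed.

Lemma spin_orthogonal x : spin e x -> x^T * x = 1.
Proof. by move=> [s [_ su ->]]; exact: prod_span_orthogonal. Qed.

Lemma spin_trmx x : spin e x -> spin e x^T.
Proof.
move=> xs; have [y ys yx] := spinV e_rel xs.
by rewrite -[x^T]mul1r -yx -mulrA (orthogonalC (spin_orthogonal xs)) mulr1.
Qed.

Lemma cl_prod_orthogonal S : (cl_prod e S)^T * cl_prod e S = 1.
Proof.
rewrite /cl_prod; elim/big_rec: _ => [|i x _ x1]; first by rewrite trmx1 mulr1.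
by apply: orthogonalM => //; rewrite e_sym e_rel.1.
Qed.

(** The transpose of the orthogonal matrix [cl_prod e S] is its inverse, and this matrix squares to
    the scalar [cl_sign S S]. *)
Lemma cl_prod_trmx S : (cl_prod e S)^T = cl_sign S S *: cl_prod e S.
Proof.
have /(congr1 (fun x => (cl_prod e S)^T * (cl_sign S S *: x))) := cl_prodM e_rel S S.
rewrite symdiffSS cl_prod0 scalerA cl_sign_sqr scale1r mulr1 => <-.
by rewrite -scalerAr mulrA cl_prod_orthogonal mul1r.
Qed.

(** Conjugation by the involution [a] preserves the trace and sends [x] to [- x]. *)
Lemma mxtrace_anticomm a x : a * a = 1 -> a * x = - (x * a) -> \tr x = 0.
Proof.
move=> a1 ax; have : \tr (x * a * a) = - \tr (x * a * a).
  by rewrite {1}mxtrace_mulC mulmxE mulrA ax mulNr linearN.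
by rewrite -mulrA a1 mulr1 => /eqP; rewrite -addr_eq0 -mulr2n mulrn_eq0 => /eqP.
Qed.

(** [e i] commutes with its own factor and anticommutes with the [#|S| - 1] others, an odd
    number. *)
Lemma cl_prod_anticomm i S : i \in S -> ~~ odd #|S| ->
  e i * cl_prod e S = - (cl_prod e S * e i).
Proof.
move=> iS S2; rewrite (mul_gen_prod e_rel) exchange_signE iS addn1 -signr_odd/=.
by rewrite S2 expr1 scaleN1r.
Qed.

Lemma mxtrace_cl_prod S : ~~ odd #|S| -> S != finset.set0 -> \tr (cl_prod e S) = 0.
Proof.
move=> S2 /set0Pn[i iS]; apply: (@mxtrace_anticomm (e i)); first exact: e_rel.1.
exact: cl_prod_anticomm.
Qed.

(** For even [S] and [T], (e_S)^T e_T is plus or minus e_(S symdiff T), of trace 0 unless S = T.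
    Evenness matters: for odd [n] the product of all generators may be a scalar matrix. *)
Lemma cl_coordE c S : cl_parity false c -> ~~ odd #|S| ->
  cl_coord c S = m.+1%:R^-1 * \tr ((cl_prod e S)^T * cl_lift e c).
Proof.
move=> c2 S2; rewrite /cl_lift [_^T * _]mulr_sumr linear_sum/= (bigD1 S)//= big1 => [|T TS].
  rewrite addr0 -scalerAr cl_prod_orthogonal linearZ/= mxtrace1 mulrC mulfK//.
rewrite -scalerAr linearZ/=; have [T2|T2] := boolP (odd #|T|).
  by rewrite c2 ?mul0r// T2.
rewrite cl_prod_trmx -scalerAl (cl_prodM e_rel) !linearZ/= mxtrace_cl_prod ?mulr0//.
  by rewrite odd_card_symdiff (negbTE S2) (negbTE T2).
by apply: contra TS => /eqP ST; have := symdiffK S T; rewrite ST symdiff0 => ->.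
Qed.

Lemma cl_lift_inj c c' : cl_parity false c -> cl_parity false c' ->
  cl_lift e c = cl_lift e c' -> c = c'.
Proof.
move=> c2 c2' cc; apply: cl_coordP => S; have [S2|S2] := boolP (odd #|S|).
  by rewrite c2 ?c2' ?S2.
by rewrite !cl_coordE// cc.
Qed.

(** A nonempty even [S] has two elements, hence one, [i], that is not the last index. As [e i]
    anticommutes with e_S and commutes with the lift of [c], the trace giving the coordinate at [S]
    vanishes. *)
Lemma cl_lift_central c : cl_parity false c ->
  (forall i : 'I_n, (i.+1 < n)%N -> cl_lift e c * e i = e i * cl_lift e c) ->
  exists a : R, cl_lift e c = a%:A.
Proof.
move=> c2 ci; exists (cl_coord c finset.set0).
rewrite {1}/cl_lift (bigD1 finset.set0)//= cl_prod0 big1 ?addr0// => S S0.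
have [S2|S2] := boolP (odd #|S|); first by rewrite c2 ?scale0r// S2.
have [i iS iN] : exists2 i, i \in S & (i.+1 < n)%N.
  apply/exists_inP; apply: contraNT S2 => /exists_inPn iN.
  suff /eqP -> : #|S| == 1%N by [].
  rewrite eqn_leq card_gt0 S0 andbT; apply/card_le1_eqP => i j iS jS.
  have last k : k \in S -> k.+1 = n.
    by move=> /iN; rewrite -leqNgt => nk; apply/eqP; rewrite eqn_leq ltn_ord.
  by apply: ord_inj; apply: succn_inj; rewrite (last i iS) (last j jS).
rewrite cl_coordE// (mxtrace_anticomm (e_rel.1 i)) ?mulr0 ?scale0r//.
rewrite -mulrA ci// !mulrA -mulNr; congr (_ * _).
have /(congr1 trmx) := cl_prod_anticomm iS S2.
by rewrite linearN/= !trmxM e_sym => ->; rewrite opprK.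
Qed.

(** An intrinsic description of Spin: even, orthogonal, and taking vectors to vectors by
    conjugation. [spin_likeP] proves the agreement; the compactness proof turns these conditions
    into closed ones. *)
Definition spin_like x := [/\ exists2 c, cl_parity false c & x = cl_lift e c,
  x^T * x = 1 & forall i, exists w, x * e i * x^T = span_vec e w].

Lemma conj_span_vec x v : (forall i, exists w, x * e i * x^T = span_vec e w) ->
  exists w, x * span_vec e v * x^T = span_vec e w.
Proof.
move=> /choice[f xf]; exists (\sum_i v 0 i *: f i).
rewrite /span_vec mulr_sumr mulr_suml -/(span_vec e _) linear_sum.
by apply: eq_bigr => i _; rewrite -scalerAr -scalerAl xf linearZ.
Qed.

Lemma spin_likeM x y : spin_like x -> spin_like y -> spin_like (x * y).
Proof.
move=> [[c c2 xc] x1 xV] [[d d2 yd] y1 yV]; split.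
- exists (c * d); first exact: (cl_parityM c2 d2).
  by rewrite (cl_liftM e_rel) xc yd.
- exact: orthogonalM.
- move=> i; have [w yw] := yV i; have [w' xw] := conj_span_vec w xV.
  by exists w'; rewrite trmxM -xw -yw !mulrA.
Qed.

Lemma spin_conj x v : spin e x -> exists w, x * span_vec e v * x^T = span_vec e w.
Proof.
move=> [s [_ + ->]]; elim: s => [|u s ih] su.
  by exists v; rewrite big_nil trmx1 mulr1 mul1r.
have {ih} [|w sw] := ih; first by move=> w ws; apply: su; rewrite inE ws orbT.
have u1 : unit_vector u by apply: su; rewrite mem_head.
exists ((2 * dot u w) *: u - w).
by rewrite big_cons trmxM span_vec_sym -!mulrA (mulrA (\prod_(_ <- _) _)) (mulrA _ (_^T)) sw
   mulrA span_vec_reflect.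
Qed.

Lemma spin_spin_like x : spin e x -> spin_like x.
Proof.
move=> xs; split; last 2 first.
- exact: spin_orthogonal.
- by move=> i; rewrite -(span_vec_gen e i); exact: spin_conj.
- have [c cs <-] := (spin_cl_lift e_rel x).1 xs.
  by exists c => //; exact: cl_parity_spin.
Qed.

Lemma orthogonal_conj_unit x v w : x^T * x = 1 -> unit_vector v ->
  x * span_vec e v * x^T = span_vec e w -> unit_vector w.
Proof.
move=> x1 v1 xw; have := span_vecK e_rel w; rewrite -xw -!mulrA.
rewrite (mulrA x^T) x1 mul1r (mulrA (span_vec e v)) span_vec_unit// mul1r.
rewrite (orthogonalC x1) => /eqP.
rewrite -[eqbLHS]scale1r -subr_eq0 -scalerBl scaler_eq0 oner_eq0 orbF subr_eq0.
by move=> /eqP/esym/unit_vectorE.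
Qed.

Lemma spin_pair u v : unit_vector u -> unit_vector v ->
  spin e (span_vec e u * span_vec e v).
Proof.
move=> u1 v1; exists [:: u; v]; split=> //; last by rewrite big_cons big_seq1.
by move=> w; rewrite !inE => /orP[]/eqP->.
Qed.

(* Move e_k back by two reflections, until only scalars are left. *)
Lemma spin_like_factor k x : (k < n)%N -> spin_like x ->
  (forall i : 'I_n, (i < k)%N -> x * e i = e i * x) ->
  exists s, [/\ ~~ odd (size s), {in s, forall v, unit_vector v},
    {in s, forall v, forall i : 'I_n, (i < k)%N -> v 0 i = 0} &
    x = \prod_(v <- s) span_vec e v].
Proof.
move=> kn; have [d] := ubnP (n - k); elim: d k x kn => // d ih k x kn nkd xs xk.
have [[c c2 xc] x1 xV] := xs.
pose ek := delta_mx 0 (Ordinal kn) : 'rV[R]_n.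
have ek1 : unit_vector ek := unit_delta _.
have eki (i : 'I_n) : (i < k)%N -> ek 0 i = 0.
  by move=> ik; rewrite mxE/=; case: eqP ik => //= ->; rewrite ltnn.
have [kn1|] := ltnP k.+1 n; last first.
  (* Here [k] is the last index, so [x] commutes with every generator except possibly that one. It
     is therefore a scalar, and orthogonality leaves 1 and -1. *)
  move=> nk; have [a xa] : exists a : R, x = a%:A.
    rewrite xc; apply: cl_lift_central => // i iN; rewrite -xc; apply: xk.
    by rewrite -ltnS (leq_trans iN).
  have : a ^+ 2 == 1.
    move: x1; rewrite xa linearZ/= trmx1 -scalerAl mul1r scalerA -expr2 => /eqP.
    by rewrite -[eqbRHS]scale1r -subr_eq0 -scalerBl scaler_eq0 oner_eq0 orbF subr_eq0.
  rewrite sqrf_eq1 => /orP[]/eqP a1.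
    by exists [::]; split=> //; rewrite big_nil xa a1 scale1r.
  (* -1 is written as e_k (- e_k), whose factors vanish on the coordinates below [k]. *)
  exists [:: ek; - ek]; split=> //.
  - move=> v; rewrite !inE => /orP[]/eqP->//; apply/unit_vectorE.
    by rewrite -scaleN1r dotZl dotZr mulrA mulrNN !mul1r; apply/unit_vectorE.
  - by move=> v; rewrite !inE => /orP[]/eqP-> i /eki // ei; rewrite mxE ei oppr0.
  - by rewrite big_cons big_seq1 linearN mulrN span_vec_unit// xa a1 scaleN1r.
have [u xu] := xV (Ordinal kn); rewrite -(span_vec_gen e) -/ek in xu.
have u1 := orthogonal_conj_unit x1 ek1 xu.
(* Since [x] commutes with [e i], its conjugation keeps the image [u] of e_k orthogonal to [e i]. *)
have ui (i : 'I_n) : (i < k)%N -> u 0 i = 0.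
  move=> ik; rewrite -dot_deltar.
  have ei0 : dot ek (delta_mx 0 i) = 0 by rewrite dot_deltar eki.
  have ux : span_vec e u * e i = - (e i * span_vec e u).
    have xi' : x^T * e i = e i * x^T.
      by have /(congr1 trmx) := xk i ik; rewrite !trmxM e_sym.
    rewrite -xu -!mulrA xi' (mulrA _ (e i)) -{1}(span_vec_gen e i).
    by rewrite (span_vec_orth e_rel ei0) span_vec_gen mulNr mulrN !mulrA xk.
  by apply: (span_vec_orthP e_rel); rewrite span_vec_gen.
(* e_(k+1) is the spare vector for the case u = - e_k; it too vanishes below [k]. *)
have [|v [v1 vu v0]] := exists_reflection e_rel u1 ek1 (unit_delta (Ordinal kn1)).
  by rewrite dot_deltar mxE eqxx -val_eqE/= ltn_eqF.
have vi (i : 'I_n) : (i < k)%N -> v 0 i = 0.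
  move=> ik; apply: v0; rewrite ?ui ?eki// mxE eqxx -val_eqE/= ltn_eqF//.
  by rewrite ltnW// ltnS.
(* Conjugation by y = v e_k sends e_k to v e_k v = u; the factor e_k makes [y] even without
   affecting this. *)
have vke := spin_pair v1 ek1; set y := span_vec e v * span_vec e ek in vke.
have y1 := spin_orthogonal vke.
have yE : y^T = span_vec e ek * span_vec e v by rewrite trmxM !span_vec_sym.
have yx : spin_like (y^T * x).
  by apply: spin_likeM => //; apply/spin_spin_like/spin_trmx.
have [|i ik|s [s2 su s0 ys]] := ih k.+1 (y^T * x) kn1 _ yx.
- by rewrite -ltnS subnSK.
- move: ik; rewrite ltnS leq_eqVlt => /orP[/eqP ik|ik].
    have -> : i = Ordinal kn by apply: val_inj.
    have xe : x * e (Ordinal kn) = span_vec e u * x.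
      by rewrite -xu -span_vec_gen -!mulrA x1 mulr1.
    rewrite -mulrA xe -vu yE !mulrA -(mulrA _ (span_vec e v) (span_vec e v)).
    by rewrite span_vec_unit// mulr1 span_vec_gen.
  have orth w : w 0 i = 0 -> span_vec e w * e i = - (e i * span_vec e w).
    by move=> wi; rewrite -(span_vec_gen e i); apply: span_vec_orth => //; rewrite dot_deltar.
  rewrite -mulrA xk// !mulrA; congr (_ * _); rewrite yE -mulrA orth ?vi// mulrN.
  by rewrite mulrA orth ?eki// mulNr opprK mulrA.
exists [:: v, ek & s]; split=> //=.
- by rewrite negbK.
- by move=> w; rewrite !inE => /or3P[/eqP->|/eqP->|/su].
- move=> w; rewrite !inE => /or3P[/eqP-> i /vi|/eqP-> i /eki|/s0 wi i ik]//.
  by apply: wi; rewrite ltnS ltnW.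
- by rewrite !big_cons mulrA -ys mulrA (orthogonalC y1) mul1r.
Qed.

Lemma spin_likeP x : (0 < n)%N -> spin e x <-> spin_like x.
Proof.
move=> n0; split; first exact: spin_spin_like.
by move=> /(spin_like_factor n0)[//|s [s2 su _ ->]]; exists s.
Qed.

End SymmetricCliffordFamily.

(** * Bivectors of square -1 *)

Section Bivectors.
Context {R : realType} {m n : nat} (e : 'I_n -> 'M[R]_m.+1).
Hypothesis e_rel : clifford_relations e.
Hypothesis e_sym : forall i, (e i)^T = e i.
Implicit Types (x y g J : 'M[R]_m.+1) (u v w : 'rV[R]_n).

Lemma mxtrace_gram_eq0 x : \tr (x^T * x) = 0 -> x = 0.
Proof.
move=> /eqP; rewrite /mxtrace psumr_eq0 => [/allP x0|i _]; last first.
  by rewrite mxE sumr_ge0// => j _; rewrite mxE -expr2 sqr_ge0.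
apply/matrixP => i j; have := x0 j (mem_index_enum _).
rewrite mxE psumr_eq0 => [/allP/(_ i (mem_index_enum _))|k _]; rewrite mxE.
  by rewrite mulf_eq0 orbb mxE => /eqP.
by rewrite -expr2 sqr_ge0.
Qed.

(** Written exactly as in [calT1], so that membership there unfolds to it. *)
Definition bivector x := exists c : 'I_n -> 'I_n -> R,
  x = \sum_(a < n) \sum_(b < n | (a < b)%N) c a b *: (e a * e b).

Lemma bivector_ind (P : 'M[R]_m.+1 -> Prop) :
  P 0 -> (forall x y, P x -> P y -> P (x + y)) ->
  (forall k (a b : 'I_n), (a < b)%N -> P (k *: (e a * e b))) ->
  forall x, bivector x -> P x.
Proof.
move=> P0 PD Pe x [c ->].
by apply: big_ind => // a _; apply: big_ind => // b ab; exact: Pe.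
Qed.

Lemma bivectorD x y : bivector x -> bivector y -> bivector (x + y).
Proof.
move=> [c ->] [d ->]; exists (fun a b => c a b + d a b).
rewrite -big_split; apply: eq_bigr => a _; rewrite -big_split; apply: eq_bigr => b _.
by rewrite scalerDl.
Qed.

Lemma bivectorZ (k : R) x : bivector x -> bivector (k *: x).
Proof.
move=> [c ->]; exists (fun a b => k * c a b).
rewrite scaler_sumr; apply: eq_bigr => a _; rewrite scaler_sumr; apply: eq_bigr => b _.
by rewrite scalerA.
Qed.

(** The coefficients are the Plücker coordinates of the pair: the terms below the diagonal are
    folded onto those above it, and the diagonal sums to <u, v> = 0. *)
Lemma bivector_mul u v : dot u v = 0 -> bivector (span_vec e u * span_vec e v).
Proof.
move=> uv; exists (fun a b => u 0 a * v 0 b - u 0 b * v 0 a).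
pose F a b := (u 0 a * v 0 b) *: (e a * e b).
have -> : span_vec e u * span_vec e v = \sum_a \sum_b F a b.
  rewrite mulr_suml; apply: eq_bigr => a _; rewrite mulr_sumr.
  by apply: eq_bigr => b _; rewrite -scalerAl -scalerAr scalerA.
have split a : \sum_b F a b =
    (u 0 a * v 0 a)%:A + \sum_(b < n | (a < b)%N) F a b + \sum_(b < n | (b < a)%N) F a b.
  rewrite (bigD1 a)//= (bigID (fun b : 'I_n => (a < b)%N))/= addrA; congr (_ + _ + _).
  - by rewrite /F e_rel.1.
  - apply: eq_bigl => b; case: ltnP; rewrite ?andbF// andbT => ab.
    by rewrite -val_eqE gtn_eqF.
  - by apply: eq_bigl => b; rewrite -leqNgt ltn_neqAle -val_eqE.
under eq_bigr do rewrite split; rewrite !big_split/= -scaler_suml -/(dot u v) uv.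
rewrite scale0r add0r [X in _ + X](exchange_big_dep xpredT)//= -big_split/=.
apply: eq_bigr => a _; rewrite -big_split; apply: eq_bigr => b ab /=.
rewrite /F (e_rel.2 b a) 1?scalerN 1?scalerBl// -val_eqE.
by rewrite gtn_eqF.
Qed.

Lemma bivector_skew x : bivector x -> x^T = - x.
Proof.
elim/bivector_ind => [|y z yT zT|k a b ab]; first by rewrite trmx0 oppr0.
  by rewrite linearD/= yT zT opprD.
rewrite linearZ/= trmxM !e_sym -scalerN (e_rel.2 b a)//.
by rewrite -val_eqE gtn_eqF.
Qed.

(** A bivector acts on vectors as an infinitesimal rotation: the bracket of e_a e_b with v is 2 v_b
    e_a - 2 v_a e_b. *)
Lemma bivector_bracket x v : bivector x ->
  exists w, x * span_vec e v - span_vec e v * x = span_vec e w.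
Proof.
elim/bivector_ind => [|y z [w yw] [w' zw]|k a b ab].
- by exists 0; rewrite mul0r mulr0 subr0 linear0.
- by exists (w + w'); rewrite mulrDl mulrDr opprD addrACA yw zw linearD.
exists (k *: ((2 * v 0 b) *: delta_mx 0 a - (2 * v 0 a) *: delta_mx 0 b)).
rewrite -scalerAl -scalerAr -scalerBr linearZ/=; congr (_ *: _).
rewrite linearB !linearZ/= !span_vec_gen -!(dot_deltar v).
set V := span_vec e v.
have eV i : e i * V = (2 * dot v (delta_mx 0 i))%:A - V * e i.
  by rewrite -(span_vec_gen e i) span_vec_anticomm// dotC.
rewrite -mulrA eV mulrBr mulrA eV mulrBl opprB.
by rewrite -scalerAr mulr1 -scalerAl mul1r !mulrA addrA addrAC addrK scalerN.
Qed.

(** By [spin_conj], e_a and e_b go to vectors that still anticommute, hence are orthogonal, and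
    [bivector_mul] applies. *)
Lemma bivector_conj g x : spin e g -> bivector x -> bivector (g * x * g^T).
Proof.
move=> gs; have g1 := spin_orthogonal e_rel e_sym gs.
elim/bivector_ind => [|y z yb zb|k a b ab].
- by exists (fun _ _ => 0); rewrite mulr0 mul0r big1// => a _; rewrite big1// => b _; rewrite scale0r.
- by rewrite mulrDr mulrDl; exact: bivectorD.
rewrite -scalerAr -scalerAl; apply: bivectorZ.
have [u gu] := spin_conj e_rel e_sym (delta_mx 0 a) gs.
have [v gv] := spin_conj e_rel e_sym (delta_mx 0 b) gs.
have ab' : e a * e b = - (e b * e a) by apply: e_rel.2; rewrite -val_eqE ltn_eqF.
have conjM y z : g * (y * z) * g^T = (g * y * g^T) * (g * z * g^T).
  by rewrite -!mulrA (mulrA g^T g) g1 mul1r.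
rewrite conjM -(span_vec_gen e a) -(span_vec_gen e b) gu gv; apply: bivector_mul.
apply: (span_vec_orthP e_rel).
by rewrite -gu -gv -!conjM !span_vec_gen ab' mulrN mulNr.
Qed.

(** If [J] commuted with all vectors, [e a] would anticommute with [e a * e b * J], which would then
    have trace 0. By linearity J^2 would have trace 0, against J^2 = -1. *)
Lemma complex_bivector_bracket_neq0 J : bivector J -> J * J = -1 ->
  exists v, J * span_vec e v - span_vec e v * J != 0.
Proof.
move=> Jb J2; apply/not_existsP => J0.
have Je i : J * e i = e i * J.
  by have /negP/negbNE := J0 (delta_mx 0 i); rewrite subr_eq0 span_vec_gen => /eqP.
have trJ x : bivector x -> \tr (x * J) = 0.
  elim/bivector_ind => [|y z yJ zJ|k a b ab]; first by rewrite mul0r linear0.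
    by rewrite mulrDl linearD/= yJ zJ addr0.
  rewrite -scalerAl linearZ/= (mxtrace_anticomm (e_rel.1 a)) ?mulr0//.
  rewrite -!mulrA Je (mulrA (e b)) (e_rel.2 b a); last by rewrite -val_eqE gtn_eqF.
  by rewrite mulNr mulrN opprK -!mulrA.
have := trJ J Jb; rewrite J2 linearN/= mxtrace1 => /eqP.
by rewrite oppr_eq0 pnatr_eq0.
Qed.

(* With D x = J x - x J, J^2 = -1 gives D^3 = - 4 D, so D acts as twice a complex
   structure on its image; a unit v in that image and w = D v / 2 span a plane
   with J = w v, since the difference has trace norm 0. *)
Lemma complex_bivector_decomposable J : bivector J -> J * J = -1 ->
  exists w v, [/\ unit_vector w, unit_vector v, dot w v = 0 &
                 J = span_vec e w * span_vec e v].
Proof.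
move=> Jb J2; have JT := bivector_skew Jb; pose D x := J * x - x * J.
have D3 x : D (D (D x)) = - (4%:R *: D x).
  have D2 y : D (D y) = - (2%:R *: (y + J * y * J)).
    rewrite /D mulrBr mulrBl !mulrA J2 -(mulrA y) J2 mulN1r mulrN1.
    by move: (J * y * J) => z; apply/matrixP => i j; rewrite !mxE; ring.
  rewrite D2 /D !mulrBr !mulrBl !mulrA J2 -!(mulrA _ J J) J2 !mulrN1 !mulN1r !mulNr.
  by move: (J * x) (x * J) => y z; apply/matrixP => i j; rewrite !mxE; ring.
have DZ k x : D (k *: x) = k *: D x by rewrite /D -scalerAl -scalerAr scalerBr.
have [v0 v00] := complex_bivector_bracket_neq0 Jb J2.
have [u0 u0E] := bivector_bracket v0 Jb.
have u00 : u0 != 0 by apply: contra v00 => /eqP u00; rewrite u0E u00 linear0.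
set v := (Num.sqrt (dot u0 u0))^-1 *: u0.
have v1 : unit_vector v := unit_vector_normalize u00.
have [w2 w2E] := bivector_bracket v Jb; pose w := 2%:R^-1 *: w2.
set V := span_vec e v; set W := span_vec e w.
have DV : D V = 2 *: W.
  by rewrite /D /V w2E /W linearZ/= scalerA mulfV ?scale1r// pnatr_eq0.
have DW : D W = - (2%:R *: V).
  have -> : W = 2^-1 *: D V by rewrite DV scalerA mulVf ?scale1r// pnatr_eq0.
  have VD : V = (Num.sqrt (dot u0 u0))^-1 *: D (span_vec e v0).
    by rewrite /V linearZ/= -u0E.
  rewrite {1}VD !DZ D3 VD !scalerN; congr (- _); rewrite !scalerA; congr (_ *: _).
  by move: (Num.sqrt _)^-1 => q; lra.
have VV : V * V = 1 by exact: span_vec_unit.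
(* D is a derivation, so V^2 = 1 gives (D V) V + V (D V) = 0. *)
have WV : W * V = - (V * W).
  have : D V * V = - (V * D V).
    by rewrite /D mulrBl mulrBr opprB -(mulrA J) (mulrA V V) VV mulr1 mul1r mulrA.
  rewrite DV -scalerAl -scalerAr -scalerN => /scalerI; apply.
  by rewrite pnatr_eq0.
have wv0 : dot w v = 0 := span_vec_orthP e_rel WV.
(* The trace of (D W) V = -2 V^2; both terms of D W contribute the same trace. *)
have trJWV : \tr (J * W * V) = - m.+1%:R.
  have := congr1 (fun x => \tr (x * V)) DW.
  rewrite /D mulrBl mulNr -scalerAl VV linearB linearN linearZ/= mxtrace1.
  rewrite -(mulrA W) (mxtrace_mulC W) mulmxE -(mulrA J V) -[V * W]opprK -WV mulrN mulrA linearN/=.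
  by rewrite opprK; lra.
(* Pairing D V = 2 W with W under the trace expresses |w|^2 through the trace just found. *)
have w1 : unit_vector w.
  have := span_vecK e_rel w; rewrite -/W => WW.
  have /(congr1 (fun x => \tr (W * x))) := DV.
  rewrite /D mulrBr linearB/= -scalerAr WW !linearZ/= mxtrace1.
  rewrite mxtrace_mulC mulmxE mulrA -(mulrA J) -[V * W]opprK -WV mulrN linearN/= mulrA trJWV.
  rewrite (mulrA W) mxtrace_mulC mulmxE mulrA trJWV => e1.
  apply/unit_vectorE; have M0 : m.+1%:R != 0 :> R by rewrite pnatr_eq0.
  by apply: (mulIf M0); lra.
exists w, v; split=> //; apply/eqP; rewrite -/V -/W -subr_eq0; apply/eqP.
(* J - W V is skew and both J and W V square to -1, so the trace norm is 2 (m + 1) + 2 tr (J W V) =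
   0. *)
apply: mxtrace_gram_eq0; have WW : W * W = 1 by exact: span_vec_unit.
have -> : (J - W * V)^T = - (J - W * V).
  by rewrite linearB/= JT trmxM !span_vec_sym// -[V * W]opprK -WV opprD.
rewrite mulNr linearN/= mulrBl !mulrBr J2 !linearB/= (mxtrace_mulC (W * V) J) mulmxE.
rewrite mulrA trJWV -mulrA (mulrA V W V) -[V * W]opprK -WV mulNr -mulrA VV mulr1 mulrN WW.
have -> : \tr (-1 : 'M[R]_m.+1) = - m.+1%:R by rewrite linearN/= mxtrace1.
by move: (m.+1%:R : R) => M; ring.
Qed.

(** First [y] moves e_i to w; the vector u = y^T v y is then orthogonal to e_i, and [z] moves e_j to
    u while fixing e_i. The third index [k] provides a spare reflection vector orthogonal to both
    e_i and e_j. *)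
Lemma spin_plane_transitive (i j k : 'I_n) w v :
  i != j -> i != k -> j != k -> unit_vector w -> unit_vector v -> dot w v = 0 ->
  exists2 g, spin e g & g * (e i * e j) * g^T = span_vec e w * span_vec e v.
Proof.
move=> ij ik jk w1 v1 wv.
have dij (a b : 'I_n) : a != b -> (delta_mx 0 a : 'rV[R]_n) 0 b = 0.
  by move=> ab; rewrite mxE eqxx eq_sym (negbTE ab).
have [|r [r1 rw _]] := exists_reflection e_rel w1 (unit_delta i) (unit_delta j).
  by rewrite dot_deltar dij// eq_sym.
have := spin_pair e r1 (unit_delta i); move Ey: (_ * _) => y ys.
have y1 := spin_orthogonal e_rel e_sym ys.
have ye : y * e i * y^T = span_vec e w.
  rewrite -rw -Ey trmxM !span_vec_sym// !span_vec_gen -!mulrA; congr (_ * _).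
  by rewrite !mulrA e_rel.1 mul1r.
have [u yu] := spin_conj e_rel e_sym v (spin_trmx e_rel e_sym ys); have yu' := yu; rewrite trmxK in yu.
have u1 : unit_vector u.
  by apply: (orthogonal_conj_unit e_rel _ v1 yu'); rewrite trmxK; exact: orthogonalC.
have ui : u 0 i = 0.
  rewrite -dot_deltar; apply: (span_vec_orthP e_rel).
  have -> : span_vec e (delta_mx 0 i) = y^T * span_vec e w * y.
    by rewrite -ye span_vec_gen -!mulrA y1 mulr1 mulrA y1 mul1r.
  rewrite -yu -!mulrA !(mulrA y y^T) (orthogonalC y1) !mul1r.
  by rewrite !(mulrA (span_vec e _) (span_vec e _)) (span_vec_orth e_rel wv) mulNr mulrN opprK.
have [|r' [r'1 r'u r'i]] := exists_reflection e_rel u1 (unit_delta j) (unit_delta k).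
  by rewrite dot_deltar dij// eq_sym.
have {}r'i : r' 0 i = 0 by apply: r'i; rewrite ?dij// eq_sym.
have := spin_pair e r'1 (unit_delta j); move Ez: (_ * _) => z zs.
have z1 := spin_orthogonal e_rel e_sym zs.
have zj : z * e j * z^T = span_vec e u.
  rewrite -r'u -Ez trmxM !span_vec_sym// !span_vec_gen -!mulrA; congr (_ * _).
  by rewrite !mulrA e_rel.1 mul1r.
have zi : z * e i = e i * z.
  rewrite -Ez -mulrA span_vec_gen (e_rel.2 j i) 1?eq_sym// mulrN mulrA.
  rewrite -{1}(span_vec_gen e i) span_vec_orth// ?dot_deltar// span_vec_gen.
  by rewrite mulNr opprK -!mulrA.
exists (y * z); first exact: spinM.
have -> : y * z * (e i * e j) * (y * z)^T = y * (e i * (z * e j * z^T)) * y^T.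
  by rewrite trmxM -!mulrA (mulrA z (e i)) zi -!mulrA.
rewrite zj -ye -!mulrA; congr (_ * (_ * _)).
have <- : y * span_vec e u * y^T = span_vec e v.
  by rewrite -yu !mulrA (orthogonalC y1) mul1r -mulrA (orthogonalC y1) mulr1.
by rewrite !mulrA y1 mul1r.
Qed.

End Bivectors.

(** * Compactness of Spin *)

Section ContinuityCompactness.

Lemma continuous_mx (R : realType) (T : topologicalType) p q (f : T -> 'M[R]_(p, q)) :
  (forall i j, continuous (fun x => f x i j)) -> continuous f.
Proof.
move=> cf x U [P Pn sPU].
apply: (@filterS _ (nbhs x) _ (fun y => forall i j, P i j (f y i j))) => [y|].
  exact: sPU.
by apply: filter_forall => i; apply: filter_forall => j; apply: cf; exact: Pn.
Qed.

Lemma continuous_sumr (R : realType) (T : topologicalType) (I : finType)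
    (f : I -> T -> R) :
  (forall i, continuous (f i)) -> continuous (fun x => \sum_i f i x).
Proof.
move=> cf; apply: continuous_big => //; exact: add_continuous.
Qed.

Lemma continuous_entry (R : realType) (T : topologicalType) p q (f : T -> 'M[R]_(p, q)) i j :
  continuous f -> continuous (fun x => f x i j).
Proof.
by move=> cf x; apply: (@continuous_comp _ _ _ f (fun M => M i j)); [exact: cf|exact: coord_continuous].
Qed.

Lemma continuous_mulmx (R : realType) (T : topologicalType) p q r
    (f : T -> 'M[R]_(p, q)) (g : T -> 'M[R]_(q, r)) :
  continuous f -> continuous g -> continuous (fun x => f x *m g x).
Proof.
move=> cf cg; apply: continuous_mx => i j.
rewrite (_ : (fun _ => _) = (fun x => \sum_k f x i k * g x k j)); last first.
  by apply/funext => x; rewrite mxE.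
apply: continuous_sumr => k x; apply: continuousM; exact: continuous_entry.
Qed.

Lemma continuous_trmx (R : realType) (T : topologicalType) p q (f : T -> 'M[R]_(p, q)) :
  continuous f -> continuous (fun x => (f x)^T).
Proof.
move=> cf; apply: continuous_mx => i j.
rewrite (_ : (fun _ => _) = (fun x => f x j i)); first exact: continuous_entry.
by apply/funext => x; rewrite mxE.
Qed.

Lemma closed_eq_continuous (R : realType) (T : topologicalType) p q
    (f g : T -> 'M[R]_(p, q)) :
  continuous f -> continuous g -> closed [set x | f x = g x].
Proof.
move=> cf cg.
rewrite (_ : [set x | _] = \bigcap_ij (fun x => f x ij.1 ij.2 - g x ij.1 ij.2) @^-1` [set 0]).
  apply: closed_bigI => ij _; apply: preimage_closed; last exact: closed_eq.
  by move=> x _; apply: continuousB; exact: continuous_entry.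
apply/seteqP; split=> [x /= fg ij _|x fg] /=; first by rewrite fg subrr.
by apply/matrixP => i j; apply/eqP; rewrite -subr_eq0; apply/eqP; exact: (fg (i, j)).
Qed.

(** A filter on the subtype is pushed forward to [X]; its cluster point in [A] clusters the original
    filter because the opens of the subtype are preimages of opens. *)
Lemma compact_set_type (X : topologicalType) (A : set X) :
  compact A -> compact [set: A].
Proof.
move=> cA F PF _.
have [|p [Ap Fp]] := cA (set_val @ F) _.
  by apply: (@filterE _ F) => x; exact: set_valP.
exists (exist _ p (mem_set Ap)); split=> // B U FB [_ [[V oV <-] /= Vp] VU].
have [|_ [[b Bb <-] Vb]] := Fp (set_val @` B) V _ (open_nbhs_nbhs (conj oV Vp)).
  by apply: (@filterS _ F _ B) FB => b Bb; exists b.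
by exists b; split=> //; exact: VU.
Qed.

Lemma hausdorff_set_type (X : topologicalType) (A : set X) :
  hausdorff_space X -> hausdorff_space A.
Proof.
move=> hX p q pq; apply: val_inj; apply: hX => U V Up Vq.
have cA : continuous (set_val : A -> X) := @initial_continuous _ _ set_val.
have [x [Ux Vx]] := pq (set_val @^-1` U) (set_val @^-1` V) (cA p _ Up) (cA q _ Vq).
by exists (set_val x).
Qed.

Lemma compact_hausdorff_inverse (X Y : topologicalType) (f : X -> Y) (h : Y -> X) :
  compact [set: X] -> hausdorff_space Y -> continuous f ->
  cancel f h -> cancel h f -> continuous h.
Proof.
move=> cX hY cf fh hf; apply/continuous_closedP => C clC.
rewrite (_ : h @^-1` C = f @` C).
  apply: compact_closed => //; apply: continuous_compact.
    exact: continuous_subspaceT.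
  exact: subclosed_compact clC cX _.
by apply/seteqP; split=> [y hC|_ [x Cx <-]] /=; [exists (h y)|rewrite fh].
Qed.

Context {R : realType} {m n : nat}.
Implicit Types (e : 'I_n -> 'M[R]_m.+1) (c : clifford R n).

Lemma continuous_cl_lift e : continuous (cl_lift e).
Proof.
apply: continuous_mx => i j.
rewrite (_ : (fun _ => _) = (fun c => \sum_S cl_coord c S * cl_prod e S i j)).
  apply: continuous_sumr => S c; apply: continuousM; last exact: cst_continuous.
  exact: (@coord_continuous R 1 #|{set 'I_n}| 0 (enum_rank S)).
apply/funext => c; rewrite /cl_lift summxE; apply: eq_bigr => S _.
by rewrite mxE.
Qed.

Hypothesis n_gt0 : (0 < n)%N.
Variable e : 'I_n -> 'M[R]_m.+1.
Hypothesis e_rel : clifford_relations e.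
Hypothesis e_sym : forall i, (e i)^T = e i.

(** Makes the coordinates of a vector continuous functions of its matrix. *)
Lemma span_vec_recover (w : 'rV[R]_n) i :
  w 0 i = m.+1%:R^-1 * \tr (e i * span_vec e w).
Proof.
have M0 : m.+1%:R != 0 :> R by rewrite pnatr_eq0.
have := congr1 mxtrace (span_vec_anticomm e_rel (delta_mx 0 i) w).
rewrite span_vec_gen dotC dot_deltar linearB linearZ/= (mxtrace_mulC (span_vec e w)) mxtrace1.
by rewrite mulmxE => e1; apply: (mulfI M0); rewrite mulrA mulfV// mul1r; lra.
Qed.

(** Presents Spin by equations between continuous functions: the existence of an image vector
    becomes equality with the trace projection onto the span of the [e j]. *)
Lemma spin_cl_genP c : spin cl_gen c <->
  [/\ cl_parity false c, (cl_lift e c)^T * cl_lift e c = 1 &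
     forall i, cl_lift e c * e i * (cl_lift e c)^T =
       \sum_j (m.+1%:R^-1 * \tr (e j * (cl_lift e c * e i * (cl_lift e c)^T))) *: e j].
Proof.
have liftE : spin cl_gen c <-> cl_parity false c /\ spin e (cl_lift e c).
  split=> [cs|[c2 /(spin_cl_lift e_rel) [c' c's cc]]].
    by split; [exact: cl_parity_spin|apply/(spin_cl_lift e_rel); exists c].
  by rewrite -(cl_lift_inj e_rel e_sym (cl_parity_spin c's) c2 cc).
rewrite liftE (spin_likeP e_rel e_sym _ n_gt0); split=> [[c2 [_ c1 cV]]|[c2 c1 cV]].
  split=> // i; have [w ->] := cV i.
  by rewrite {1}/span_vec; apply: eq_bigr => j _; rewrite -span_vec_recover.
split=> //; split=> [||i]; [by exists c|by []|].
exists (\row_j (m.+1%:R^-1 * \tr (e j * (cl_lift e c * e i * (cl_lift e c)^T)))).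
by rewrite cV; apply: eq_bigr => j _; rewrite mxE -cV.
Qed.

(** By trace orthogonality this sum is the trace norm divided by m + 1. It bounds the coordinates on
    Spin. *)
Lemma cl_coord_norm c : cl_parity false c -> (cl_lift e c)^T * cl_lift e c = 1 ->
  \sum_S cl_coord c S ^+ 2 = 1.
Proof.
move=> c2 /(congr1 mxtrace); rewrite mxtrace1 {1}/cl_lift linear_sum/= mulr_suml linear_sum/=.
have M0 : m.+1%:R != 0 :> R by rewrite pnatr_eq0.
move=> c1; apply: (mulfI M0); rewrite mulr1 -[RHS]c1 mulr_sumr; apply: eq_bigr => S _.
rewrite linearZ/= -scalerAl linearZ/=; have [S2|S2] := boolP (odd #|S|).
  by rewrite c2 ?S2// expr0n mulr0 mul0r.
by rewrite expr2 [X in _ * (_ * X)](cl_coordE e_rel e_sym c2 S2) mulrCA mulVKf.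
Qed.

Lemma compact_spin : compact (spin (@cl_gen R n)).
Proof.
(* The cube [-1, 1]^(2^n), which contains Spin because the squared coordinates sum to 1. *)
pose B : set (clifford R n) :=
  [set c : 'rV[R]_#|{set 'I_n}| | forall i, `[-1, 1]%classic (c ord0 i)].
have cB : compact B.
  by apply: (@rV_compact R _ (fun=> `[-1, 1]%classic)) => i; exact: segment_compact.
apply: (subclosed_compact _ cB) => [|c /spin_cl_genP[c2 c1 _] k]; last first.
  have := cl_coord_norm c2 c1; rewrite (bigD1 (enum_val k))//= => c1'.
  have : cl_coord c (enum_val k) ^+ 2 <= 1.
    by rewrite -c1' lerDl sumr_ge0// => S _; rewrite sqr_ge0.
  by rewrite -real_normK ?num_real// expr_le1// /cl_coord enum_valK /= in_itv/= -ler_norml.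
pose L (c : clifford R n) := cl_lift e c.
have cL : continuous L := @continuous_cl_lift e.
have cconj i : continuous (fun c => L c * e i * (L c)^T).
  apply: continuous_mulmx; last exact: continuous_trmx.
  by apply: continuous_mulmx => //; exact: cst_continuous.
rewrite (_ : spin _ = (\bigcap_(S in [set S : {set 'I_n} | odd #|S|]) [set c | cl_coord c S = 0]) `&`
   [set c | (L c)^T * L c = 1] `&`
   \bigcap_i [set c | L c * e i * (L c)^T =
     \sum_j (m.+1%:R^-1 * \tr (e j * (L c * e i * (L c)^T))) *: e j]).
  apply: closedI; first apply: closedI.
  - apply: closed_bigI => S _; apply: (@preimage_closed _ R (fun c => cl_coord c S) [set 0]); last exact: closed_eq.
    by move=> c _; exact: (@coord_continuous R 1 #|{set 'I_n}| 0 (enum_rank S)).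
  - apply: closed_eq_continuous; last exact: cst_continuous.
    by apply: continuous_mulmx => //; exact: continuous_trmx.
  - apply: closed_bigI => i _; apply: closed_eq_continuous => //.
    pose tr j (c : clifford R n) : R := \tr (e j * (L c * e i * (L c)^T)).
    have ctr j : continuous (tr j).
      apply: continuous_sumr => k; apply: continuous_entry.
      by apply: continuous_mulmx => //; exact: cst_continuous.
    apply: continuous_mx => a b.
    rewrite (_ : (fun _ => _) = fun c => \sum_j (m.+1%:R^-1 * tr j c) * e j a b); last first.
      by apply/funext => c; rewrite summxE; apply: eq_bigr => j _; rewrite mxE.
    apply: continuous_sumr => j c.
    apply: (@continuousM R _ (fun c => m.+1%:R^-1 * tr j c) (fun=> e j a b)); last exact: cst_continuous.
    by apply: (@continuousM R _ (fun=> m.+1%:R^-1) (tr j)); [exact: cst_continuous|exact: ctr].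
apply/seteqP; split=> c.
  move=> /spin_cl_genP[c2 c1 cV]; split; first split.
  - by move=> S /= oS; apply: c2; rewrite oS.
  - exact: c1.
  - by move=> i _; exact: cV.
move=> [[c2 c1] cV]; apply/spin_cl_genP; split=> [S|//|i]; last exact: cV.
by rewrite eqbF_neg negbK => oS; exact: c2.
Qed.

Lemma compact_Spin : compact [set: Spin R n].
Proof. exact/compact_set_type/compact_spin. Qed.

End ContinuityCompactness.

(** * The stabilizer of an oriented plane *)

Section PlaneStabilizer.
Context {R : realType} {m n : nat} (e : 'I_(2 + n.+1) -> 'M[R]_m.+1).
Hypothesis e_rel : clifford_relations e.
Hypothesis e_sym : forall i, (e i)^T = e i.
Implicit Types (x y z g : 'M[R]_m.+1) (p q : (Spin R 2 * Spin R n.+1)%type).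

(** The first two generators span the plane of [J], the others its orthogonal complement. *)
Let el (i : 'I_2) := e (lshift n.+1 i).
Let er (i : 'I_n.+1) := e (rshift 2 i).
Let J := el 0 * el 1.

Lemma clifford_relations_inj k (f : 'I_k -> 'I_(2 + n.+1)) :
  injective f -> clifford_relations (fun i => e (f i)).
Proof.
move=> f_inj; split=> [i|i j ij]; first exact: e_rel.1.
by apply: e_rel.2; apply: contra ij => /eqP/f_inj ->.
Qed.

Let el_rel : clifford_relations el := clifford_relations_inj (@lshift_inj _ _).
Let er_rel : clifford_relations er := clifford_relations_inj (@rshift_inj _ _).
Let el_sym i : (el i)^T = el i := e_sym _.
Let er_sym i : (er i)^T = er i := e_sym _.

Lemma span_vec_row_mx (u : 'rV[R]_2) (v : 'rV[R]_n.+1) :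
  span_vec e (row_mx u v) = span_vec el u + span_vec er v.
Proof.
rewrite /span_vec big_split_ord; congr (_ + _); apply: eq_bigr => i _.
  by rewrite row_mxEl.
by rewrite row_mxEr.
Qed.

Lemma unit_row_mxl (u : 'rV[R]_2) :
  unit_vector (row_mx u (0 : 'rV[R]_n.+1)) <-> unit_vector u.
Proof.
rewrite /unit_vector/= big_split_ord/= [X in _ + X]big1 ?addr0 => [|i _].
  by under eq_bigr => i _ do rewrite row_mxEl.
by rewrite row_mxEr mxE expr0n.
Qed.

Lemma unit_row_mxr (v : 'rV[R]_n.+1) :
  unit_vector (row_mx (0 : 'rV[R]_2) v) <-> unit_vector v.
Proof.
rewrite /unit_vector/= big_split_ord/= [X in X + _]big1 ?add0r => [|i _].
  by under eq_bigr => i _ do rewrite row_mxEr.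
by rewrite row_mxEl mxE expr0n.
Qed.

Lemma spin_el y : spin el y -> spin e y.
Proof.
move=> [s [s2 su ->]]; exists [seq row_mx u 0 | u <- s]; split.
- by rewrite size_map.
- by move=> _ /mapP[u /su u1 ->]; exact/unit_row_mxl.
- by rewrite big_map; apply: eq_bigr => u _; rewrite span_vec_row_mx linear0 addr0.
Qed.

Lemma spin_er z : spin er z -> spin e z.
Proof.
move=> [s [s2 su ->]]; exists [seq row_mx 0 v | v <- s]; split.
- by rewrite size_map.
- by move=> _ /mapP[v /su v1 ->]; exact/unit_row_mxr.
- by rewrite big_map; apply: eq_bigr => v _; rewrite span_vec_row_mx linear0 add0r.
Qed.

Lemma el_er_anticomm i j : el i * er j = - (er j * el i).
Proof. by apply: e_rel.2; rewrite eq_lrshift. Qed.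

Lemma el01 : el 0 * el 1 = - (el 1 * el 0).
Proof. exact: el_rel.2. Qed.

Lemma spin_el_comm_er y i : spin el y -> y * er i = er i * y.
Proof.
move=> [s [s2 _ ->]]; apply: prod_even_comm => // v _.
rewrite /span_vec mulr_suml mulr_sumr -sumrN; apply: eq_bigr => j _.
by rewrite -scalerAl el_er_anticomm scalerN -scalerAr.
Qed.

(** Each vector of the plane anticommutes with [J], and an even number of signs cancel. *)
Lemma spin_el_comm_J y : spin el y -> y * J = J * y.
Proof.
move=> [s [s2 _ ->]]; apply: prod_even_comm => // v _.
rewrite /span_vec mulr_suml mulr_sumr -sumrN; apply: eq_bigr => j _.
rewrite -scalerAl -scalerAr -scalerN; congr (_ *: _); rewrite /J.
have [->|->] : j = 0 \/ j = 1.
  by case: j => -[|[|//]] j2; [left|right]; apply: val_inj.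
  by rewrite mulrA el_rel.1 mul1r el01 mulNr opprK -mulrA el_rel.1 mulr1.
by rewrite el01 mulrN mulrA el_rel.1 mul1r -el01 -mulrA el_rel.1 mulr1.
Qed.

Lemma spin_er_comm_el z i : spin er z -> z * el i = el i * z.
Proof.
move=> [s [s2 _ ->]]; apply: prod_even_comm => // v _.
rewrite /span_vec mulr_suml mulr_sumr -sumrN; apply: eq_bigr => j _.
by rewrite -scalerAl -scalerAr el_er_anticomm scalerN opprK.
Qed.

Lemma spin_er_comm_J z : spin er z -> z * J = J * z.
Proof.
move=> zs; rewrite /J mulrA (spin_er_comm_el 0 zs) -(mulrA (el 0) z).
by rewrite (spin_er_comm_el 1 zs) mulrA.
Qed.

Lemma spin_el_er_comm y z : spin el y -> spin er z -> y * z = z * y.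
Proof.
move=> ys [s [_ _ ->]]; apply: commr_prod => v _; apply: commr_sum => i _.
by rewrite /GRing.comm -scalerAr -scalerAl spin_el_comm_er.
Qed.

(** Multiplication of Spin(2) and Spin(n+1) inside the matrices. It is a homomorphism because the
    two factors commute, and its kernel is the subgroup divided out in the quotient. *)
Definition spin_mul_map p : 'M[R]_m.+1 :=
  cl_lift el (set_val p.1) * cl_lift er (set_val p.2).

Let lift_el (a : Spin R 2) : spin el (cl_lift el (set_val a)).
Proof. by apply/(spin_cl_lift el_rel); exists (set_val a) => //; exact: spinP. Qed.

Let lift_er (b : Spin R n.+1) : spin er (cl_lift er (set_val b)).
Proof. by apply/(spin_cl_lift er_rel); exists (set_val b) => //; exact: spinP. Qed.

Lemma spin_mul_mapM p q :
  spin_mul_map (p * q)%g = spin_mul_map p * spin_mul_map q.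
Proof.
rewrite /spin_mul_map /= (cl_liftM el_rel) (cl_liftM er_rel). rewrite -!mulrA; congr (_ * _).
by rewrite !mulrA; congr (_ * _); exact: spin_el_er_comm.
Qed.

Lemma spin_mul_map1 : spin_mul_map 1%g = 1.
Proof. by rewrite /spin_mul_map /= !cl_lift1 mulr1. Qed.

Lemma spin_mul_mapN1 : spin_mul_map (spinN1, spinN1) = 1.
Proof. by rewrite /spin_mul_map /= !linearN/= !cl_lift1 mulrNN mulr1. Qed.

(** If y z = 1, then y = z^T lies in both factors, so it commutes with e_0 and is a scalar, 1 or -1
    by orthogonality. Injectivity of the lifts on even elements then determines [p]. *)
Lemma spin_mul_map_ker p : spin_mul_map p = 1 -> p = 1%g \/ p = (spinN1, spinN1).
Proof.
case: p => a b; rewrite /spin_mul_map /= => ab.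
set y := cl_lift el _ in ab; set z := cl_lift er _ in ab.
have z1 : z^T * z = 1 := spin_orthogonal er_rel er_sym (lift_er b).
have yz : y = z^T by rewrite -[LHS]mulr1 -(orthogonalC z1) mulrA ab mul1r.
have zs : spin er z^T := spin_trmx er_rel er_sym (lift_er b).
have a2 := cl_parity_spin (spinP a); have b2 := cl_parity_spin (spinP b).
have [k yk] : exists k : R, y = k%:A.
  by apply: (cl_lift_central el_rel el_sym a2) => i _; rewrite -/y yz spin_er_comm_el.
have k1 : k ^+ 2 == 1.
  have := spin_orthogonal el_rel el_sym (lift_el a).
  rewrite -/y yk linearZ/= trmx1 -scalerAl mul1r scalerA -expr2 => /eqP.
  by rewrite -[eqbRHS]scale1r -subr_eq0 -scalerBl scaler_eq0 oner_eq0 orbF subr_eq0.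
have N1 : cl_parity false (- 1 : clifford R 2) /\ cl_parity false (-1 : clifford R n.+1).
  by split; apply: cl_parity_spin; exact: spinN1_subproof.
move: k1; rewrite sqrf_eq1 => /orP[]/eqP k1; [left|right].
  have y1 : y = 1 by rewrite yk k1 scale1r.
  have z1' : z = 1 by rewrite -ab y1 mul1r.
  congr pair; apply: val_inj.
    by apply: (cl_lift_inj el_rel el_sym a2 (@cl_parity1 _ _)); rewrite cl_lift1.
  by apply: (cl_lift_inj er_rel er_sym b2 (@cl_parity1 _ _)); rewrite cl_lift1.
have y1 : y = -1 by rewrite yk k1 scaleN1r.
have z1' : z = -1 by rewrite -ab y1 mulN1r opprK.
congr pair; apply: val_inj.
  by apply: (cl_lift_inj el_rel el_sym a2 N1.1); rewrite linearN/= cl_lift1.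
by apply: (cl_lift_inj er_rel er_sym b2 N1.2); rewrite linearN/= cl_lift1.
Qed.

Lemma spin_mul_map_spin p : spin e (spin_mul_map p).
Proof. by apply: spinM; [exact: spin_el|exact: spin_er]. Qed.

Lemma spin_mul_map_comm p : spin_mul_map p * J = J * spin_mul_map p.
Proof. by rewrite /spin_mul_map -mulrA spin_er_comm_J// mulrA spin_el_comm_J// mulrA. Qed.

(* g maps e_0 into the plane, since its image anticommutes with J; undoing this
   rotation leaves an element commuting with e_0 and J, hence with e_1. *)
Lemma spin_mul_map_surj g : spin e g -> g * J = J * g -> exists p, spin_mul_map p = g.
Proof.
move EJ: J => j gs gJ; have g1 := spin_orthogonal e_rel e_sym gs.
have [u gu] := spin_conj e_rel e_sym (delta_mx 0 (lshift n.+1 0)) gs.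
have u1 := orthogonal_conj_unit e_rel g1 (unit_delta _) gu.
rewrite span_vec_gen -/(el 0) in gu.
rewrite -[u]hsubmxK in u1 gu; set ul := lsubmx u in u1 gu; set ur := rsubmx u in u1 gu.
have el0J : el 0 * j = - (j * el 0).
  by rewrite -EJ /J mulrA el_rel.1 mul1r el01 mulNr opprK -mulrA el_rel.1 mulr1.
have gTJ : g^T * j = j * g^T.
  have JT : j^T = - j by rewrite -EJ /J trmxM !el_sym el01 opprK.
  by have := congr1 trmx gJ; rewrite (trmxM g j) (trmxM j g) JT mulrN mulNr => /oppr_inj ->.
have uJ : span_vec e (row_mx ul ur) * j = - (j * span_vec e (row_mx ul ur)).
  by rewrite -gu -!mulrA gTJ (mulrA (el 0)) el0J mulNr mulrN !mulrA gJ.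
have ulJ : span_vec el ul * j = - (j * span_vec el ul).
  rewrite /span_vec mulr_suml mulr_sumr -sumrN; apply: eq_bigr => k _.
  rewrite -scalerAl -scalerAr -scalerN; congr (_ *: _).
  have [->//|->] : k = 0 \/ k = 1.
    by case: k => -[|[|//]] k2; [left|right]; apply: val_inj.
  by rewrite -EJ /J el01 mulrN mulrA el_rel.1 mul1r -el01 -mulrA el_rel.1 mulr1.
have urJ : span_vec er ur * j = j * span_vec er ur.
  rewrite /span_vec mulr_suml mulr_sumr; apply: eq_bigr => k _.
  rewrite -scalerAl -scalerAr; congr (_ *: _); rewrite -EJ /J.
  have erl i : er k * el i = - (el i * er k) by rewrite el_er_anticomm opprK.
  by rewrite mulrA erl mulNr -mulrA erl mulrN opprK mulrA.
(* The part [ul] anticommutes with [j], [ur] commutes with it, and their sum anticommutes; hence [j]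
   kills [ur], and [j] is invertible. *)
have ur0 : ur = 0.
  move: uJ; rewrite span_vec_row_mx mulrDl mulrDr ulJ urJ opprD => /addrI /eqP.
  rewrite -addr_eq0 -mulr2n -scaler_nat scaler_eq0 pnatr_eq0/= => /eqP JV.
  apply: (span_vec_eq0 er_rel).
  have JJ : j * j = -1.
    by rewrite -EJ {2}/J el01 mulrN /J mulrA -(mulrA (el 0)) el_rel.1 mulr1 el_rel.1.
  by rewrite -[LHS]mul1r -[1]opprK -JJ mulNr -mulrA JV mulr0 oppr0.
have ul1 : unit_vector ul by apply/unit_row_mxl; rewrite -ur0.
rewrite ur0 span_vec_row_mx linear0 addr0 in gu.
(* Everything takes place in the plane: e_1 is the spare vector when e_0 is moved to [ul]. *)
have [|r [r1 ru _]] := exists_reflection el_rel ul1 (unit_delta 0) (unit_delta 1).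
  by rewrite dot_deltar mxE.
have := spin_pair el r1 (unit_delta 0); move Ey: (_ * _) => y ys.
have y1 := spin_orthogonal el_rel el_sym ys.
have yT : spin el y^T := spin_trmx el_rel el_sym ys.
have ye : y * el 0 * y^T = span_vec el ul.
  rewrite -ru -Ey trmxM !span_vec_sym// !span_vec_gen -!mulrA; congr (_ * _).
  by rewrite !mulrA el_rel.1 mul1r.
have zs : spin e (y^T * g) by apply: spinM => //; exact: spin_el.
have z0 : y^T * g * el 0 = el 0 * (y^T * g).
  have ge : g * el 0 = span_vec el ul * g by rewrite -gu -!mulrA g1 mulr1.
  by rewrite -mulrA ge -ye !mulrA y1 mul1r.
have zJ : y^T * g * j = j * (y^T * g).
  by rewrite -mulrA gJ !mulrA -EJ (spin_el_comm_J yT).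
have z1 : y^T * g * el 1 = el 1 * (y^T * g).
  have -> : el 1 = el 0 * j by rewrite -EJ /J mulrA el_rel.1 mul1r.
  by rewrite mulrA z0 -(mulrA (el 0) (y^T * g)) zJ mulrA.
(* Factoring from [k] = 2 yields unit vectors that vanish on the first two coordinates, so the
   product lies in the Spin group of the complement. *)
have [//|i i2|s [s2 su s0 zE]] := spin_like_factor e_rel e_sym (k := 2) _ (spin_spin_like e_rel e_sym zs).
  have -> : i = lshift n.+1 (Ordinal i2) by apply: val_inj.
  case: (Ordinal i2) => -[|[|//]] j2; rewrite -/(el _).
    by rewrite (_ : Ordinal _ = 0) //; apply: val_inj.
  by rewrite (_ : Ordinal _ = 1) //; apply: val_inj.
have sr v : v \in s -> row_mx 0 (rsubmx v) = v.
  move=> vs; rewrite -[RHS]hsubmxK; congr row_mx.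
  by apply/rowP => i; rewrite !mxE (s0 v vs)//; exact: (ltn_ord i).
have ers : spin er (y^T * g).
  exists [seq rsubmx v | v <- s]; split; first by rewrite size_map.
    by move=> _ /mapP[v vs ->]; apply/unit_row_mxr; rewrite sr//; exact: su.
  rewrite big_map {1}zE; apply: eq_big_seq => v vs.
  by rewrite -{1}(sr v vs) span_vec_row_mx linear0 add0r.
have [a as_ ay] := (spin_cl_lift el_rel y).1 ys.
have [b bs bz] := (spin_cl_lift er_rel _).1 ers.
exists (spin_of as_, spin_of bs).
by rewrite /spin_mul_map /= ay bz mulrA (orthogonalC y1) mul1r.
Qed.

Lemma continuous_spin_mul_map : continuous spin_mul_map.
Proof.
apply: continuous_mulmx => p.
  apply: (@continuous_comp _ _ _ (fun p => set_val p.1) (cl_lift el)); last exact: continuous_cl_lift.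
  apply: (@continuous_comp _ _ _ fst set_val); first exact: cvg_fst.
  exact: initial_continuous.
apply: (@continuous_comp _ _ _ (fun p => set_val p.2) (cl_lift er)); last exact: continuous_cl_lift.
apply: (@continuous_comp _ _ _ snd set_val); first exact: cvg_snd.
exact: initial_continuous.
Qed.

Lemma compact_Spin_pair : compact [set: Spin R 2 * Spin R n.+1].
Proof.
rewrite -setXTT; apply: compact_setX.
  exact: (compact_Spin _ el_rel el_sym).
exact: (compact_Spin _ er_rel er_sym).
Qed.

End PlaneStabilizer.

(** * The isotropy group as a quotient of Spin(2) x Spin(7) *)

Section Isotropy.
Context {R : realType} {m : nat}.
Implicit Types (g j : 'M[R]_m.+1).

Lemma conj_mx_orthogonal g j : g^T * g = 1 -> conj_mx g j = g * j * g^T.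
Proof.
move=> g1; rewrite /conj_mx; congr (_ *m _).
have [_ gu] := mulmx1_unit g1.
by rewrite -[invmx g]mul1mx -[1%:M]g1 -mulmxA mulmxV// mulmx1.
Qed.

Lemma conj_mx_fixed g j : g^T * g = 1 -> conj_mx g j = j <-> g * j = j * g.
Proof.
move=> g1; rewrite conj_mx_orthogonal//; split=> [gj|->].
  by rewrite -{2}gj -!mulrA g1 mulr1.
by rewrite -mulrA (orthogonalC g1) mulr1.
Qed.

Variable e : 'I_(2 + 7) -> 'M[R]_m.+1.
Hypothesis e_rel : clifford_relations e.
Hypothesis e_sym : forall i, (e i)^T = e i.

Let J := e (lshift 7 0) * e (lshift 7 1).
Let G := isotropy (spin e) J.
Let Q := Spin2xSpin7 R.
Let F := @spin_mul_map R m 6 e.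
Let pi (p : Spin R 2 * Spin R 7) : Q := spin27_pi p.

Let isotropyE g : G g <-> spin e g /\ g * J = J * g.
Proof.
split=> [[gs gJ]|[gs gJ]]; split=> //.
  by apply/conj_mx_fixed => //; exact: (spin_orthogonal e_rel e_sym).
by apply/conj_mx_fixed => //; exact: (spin_orthogonal e_rel e_sym).
Qed.

Let FG p : G (F p).
Proof.
by apply/isotropyE; split; [exact: spin_mul_map_spin|exact: spin_mul_map_comm].
Qed.

(** [F] is multiplicative with kernel [spin27_diag], so it induces an injective map on the
    quotient. *)
Let F_pi p q : F p = F q <-> pi p = pi q.
Proof.
have Fp1 x : F x = 1 <-> x \in spin27_diag.
  split=> [/(spin_mul_map_ker e_rel e_sym)[]->|]; rewrite !inE ?eqxx ?orbT//.
  move=> /orP[]/eqP->; [exact: spin_mul_map1|exact: spin_mul_mapN1].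
have FV : F (p^-1)%g * F p = 1 by rewrite -spin_mul_mapM// mulVg; exact: spin_mul_map1.
have FVr : F p * F (p^-1)%g = 1 by rewrite -spin_mul_mapM// mulgV; exact: spin_mul_map1.
have Fpq : pi p = pi q <-> F (p^-1)%g * F q = 1.
  by rewrite -spin_mul_mapM// Fp1; split=> /spin27_piP.
by rewrite Fpq; split=> [<-//|pq]; rewrite -[RHS]mul1r -FVr -mulrA pq mulr1.
Qed.

Let repr_pi (x : Q) : exists p, pi p = x.
Proof. by exists (repr (x : {eq_quot (@spin27_equiv R)}%qT)); exact: reprK. Qed.

Lemma isotropy_isomorphic : isomorphic_to_mx_group (fun x y : Q => (x * y)%g) G.
Proof.
have [r rK] := choice repr_pi.
have [s sK] := choice (fun g : G => spin_mul_map_surj e_rel e_sym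
  ((isotropyE (set_val g)).1 (set_valP g)).1 ((isotropyE (set_val g)).1 (set_valP g)).2).
(* [f] applies [F] to a chosen representative and [h] takes the class of a chosen preimage; by
   [F_pi] the choices do not matter. *)
pose f (x : Q) : G := exist _ (F (r x)) (mem_set (FG (r x))).
pose h (g : G) : Q := pi (s g).
have fE p : set_val (f (pi p)) = F p by apply/F_pi; rewrite rK.
have fK : cancel f h.
  by move=> x; rewrite -[RHS]rK; apply/F_pi; exact: (sK (f x)).
have hK : cancel h f.
  by move=> g; apply: val_inj; exact: (etrans (fE (s g)) (sK g)).
have cf : continuous f.
  apply: (@continuous_comp_initial _ _ _ (set_val : G -> 'M[R]_m.+1)).
  (* Continuity on the quotient reduces to that of the composite with the projection, which is
     [F]. *)
  apply/quotient_continuous.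
  rewrite (_ : _ \o _ = F); first exact: continuous_spin_mul_map.
  by apply/funext => p; exact: fE.
exists f, h; split=> //; last first.
  move=> x y; rewrite -(rK x) -(rK y) -[(_ * _)%g]/(spin27_mul _ _) spin27_piM.
  by rewrite !fE; exact: spin_mul_mapM.
apply: (compact_hausdorff_inverse _ _ cf fK hK).
  rewrite (_ : [set: Q] = pi @` setT).
    apply: continuous_compact; last exact: (compact_Spin_pair e_rel e_sym).
    by apply: continuous_subspaceT; exact: pi_continuous.
  by apply/seteqP; split=> // x _; exists (r x).
exact/hausdorff_set_type/norm_hausdorff.
Qed.

End Isotropy.

(** * Conjugation action of Spin(9) on the bivectors of square -1 *)

Theorem proposition1 (R : realType) (I : 'I_9 -> 'M[R]_16)
    (I_sym : forall a, (I a)^T = I a)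
    (I_sqr : forall a, I a *m I a = 1%:M)
    (I_anti : forall a b, a != b -> I a *m I b = - (I b *m I a)) :
  let Spin9 : set 'M[R]_16 := spin I in
  let J12 := I ord0 *m I (inord 1) in
  let U8 := unitary_group J12 in
  [/\ acts_transitively_by_conj Spin9 (calT1 I),
      calT1 I J12,
      isotropy Spin9 J12 = Spin9 `&` U8
    & isomorphic_to_mx_group (fun x y : Spin2xSpin7 R => (x * y)%g)
        (isotropy Spin9 J12)].
Proof.
move=> Spin9 J12 U8.
have I_rel : clifford_relations I by split.
have calT1E j : calT1 I j <-> bivector I j /\ j * j = -1 by [].
have spinO g : Spin9 g -> g^T * g = 1 by exact: (spin_orthogonal I_rel I_sym).
have ij : ord0 != inord 1 :> 'I_9 by rewrite -val_eqE /= inordK.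
(* The index 2 supplies the spare vector of [spin_plane_transitive]. *)
have ik : ord0 != inord 2 :> 'I_9 by rewrite -val_eqE /= inordK.
have jk : inord 1 != inord 2 :> 'I_9 by rewrite -val_eqE /= !inordK.
have TJ12 : calT1 I J12.
  apply/calT1E; split.
    rewrite /J12 mulmxE -!(span_vec_gen I); apply: bivector_mul => //.
    by rewrite dot_deltar mxE eqxx eq_sym (negbTE ij).
  rewrite /J12 !mulmxE {2}(I_rel.2 _ _ ij) mulrN -mulrA (mulrA (I (inord 1))).
  by rewrite I_rel.1 mul1r I_rel.1.
have Tact : acts_by_conj Spin9 (calT1 I).
  move=> g j gs /calT1E[jb j2]; have g1 := spinO g gs.
  rewrite conj_mx_orthogonal//; apply/calT1E; split.
    exact: (bivector_conj I_rel I_sym gs jb).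
  rewrite -!mulrA (mulrA g^T) g1 mul1r (mulrA j) j2 mulN1r mulrN.
  by rewrite (orthogonalC g1).
have from12 j : calT1 I j -> exists2 g, Spin9 g & g * J12 * g^T = j.
  move=> /calT1E[jb j2].
  have [w [v [w1 v1 wv ->]]] := complex_bivector_decomposable I_rel I_sym jb j2.
  exact: (spin_plane_transitive I_rel I_sym ij ik jk w1 v1 wv).
split=> //.
- split=> //; first by exists J12.
  move=> j j' /from12[g gs <-] /from12[g' g's <-].
  (* Both operators are reached from I_1 I_2, so going back along [g] and then along [g'] carries
     the first to the second. *)
  exists (g' * g^T); first by apply: spinM => //; exact: spin_trmx.
  have g1 := spinO _ gs; rewrite conj_mx_orthogonal.
    by rewrite trmxM trmxK -!mulrA !(mulrA g^T g) g1 !mul1r.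
  by apply: orthogonalM; [exact: spinO|rewrite trmxK; exact: orthogonalC].
(* Elements of Spin(9) are orthogonal, so on both sides the remaining condition is to commute with
   I_1 I_2. *)
- apply/seteqP; split=> g [gs gJ]; have g1 := spinO g gs; split=> //.
    by split=> //; apply/(conj_mx_fixed _ g1).
  by apply/(conj_mx_fixed _ g1); case: gJ.
(* The nine indices are read as 2 + 7 by conversion; I_1 and I_2 are the two generators of the first
   block. *)
- have J12E : J12 = (I : 'I_(2 + 7) -> _) (lshift 7 0) * (I : 'I_(2 + 7) -> _) (lshift 7 1).
    by congr (I _ *m I _); apply: val_inj => //=; rewrite inordK.
  by rewrite J12E; exact: (@isotropy_isomorphic R 15 I I_rel I_sym).
Qed.
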